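(* Let $D$ be a maximal (with respect to inclusion) subset of pairwise orthogonal roots of $$D_{\mathrm{reg}}=\{2\epsilon_1,2\epsilon_2,\dots,2\epsilon_n,\ \epsilon_1+\epsilon_2,\epsilon_2+\epsilon_3,\dots,\epsilon_{n-1}+\epsilon_n\}\subset\Phi^+,$$ and let $\xi=(\xi_\beta)_{\beta\in D}$ be a family of elements of $\mathbb F_q$ such that $\xi_\beta\ne0$ for all $\beta\in D\setminus\{2\epsilon_n\}$ (if $2\epsilon_n\in D$, then $\xi_{2\epsilon_n}$ is allowed to be zero). Put $$f=f_{D,\xi}=\sum_{\beta\in D}\xi_\beta e_\beta^*\in\mathfrak u^*.$$ Then the coadjoint $U$-orbit of $f$ has maximal dimension among all coadjoint orbits of $U$ in $\mathfrak u^*$. Conversely, each coadjoint orbit of maximal dimension contains exactly one linear form of this kind (as $D$ and $\xi$ vary).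
   Context: Let $n\ge1$, $m=2n$, and let $\mathbb{F}_q$ be a finite field of characteristic $p\ge 2n$. Let $\Phi=C_n$ with positive roots $\Phi^+=\{\epsilon_i\pm\epsilon_j: 1\le i<j\le n\}\cup\{2\epsilon_i:1\le i\le n\}\subset\mathbb R^n$ ($\epsilon_i$ the standard basis, standard inner product). Index rows and columns of $m\times m$ matrices by $1,2,\dots,n,-n,\dots,-2,-1$, with elementary matrices $e_{a,b}$. Put $e_{2\epsilon_i}=e_{-i,i}$, $e_{\epsilon_i-\epsilon_j}=e_{j,i}-e_{-i,-j}$, $e_{\epsilon_i+\epsilon_j}=e_{-j,i}+e_{-i,j}$ ($i<j$). Let $\mathfrak{u}\subset\mathfrak{gl}_m(\mathbb{F}_q)$ be the Lie algebra with basis $e_\alpha$, $\alpha\in\Phi^+$, and $U=\exp(\mathfrak{u})$, a maximal unipotent subgroup of $\mathrm{Sp}_{2n}(\mathbb F_q)$, where $\exp(x)=\sum_{i=0}^{m-1}x^i/i!$. Let $\{e_\alpha^*\}$ be the basis of $\mathfrak u^*$ dual to $\{e_\alpha\}$. The group $U$ acts on $\mathfrak u^*$ by the coadjoint action $(g.f)(x)=f(g^{-1}xg)$. The dimension of a coadjoint orbit $\Omega$ is the integer $\dim\Omega$ with $|\Omega|=q^{\dim\Omega}$. *)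

(* Defs.v *)
From HB Require Import structures.
From mathcomp Require Import all_boot all_order all_fingroup all_algebra all_field.
From mathcomp Require Import ring lra zify.

Set Implicit Arguments.
Unset Strict Implicit.
Unset Printing Implicit Defensive.

Import GRing.Theory.
Local Open Scope ring_scope.

Definition ltpair (n : nat) := {ij : 'I_n * 'I_n | (ij.1 < ij.2)%N}.

(* [Long i] is 2 eps_i, [Sum (i, j)] is eps_i + eps_j and [Diff (i, j)] is
   eps_i - eps_j, where i < j.  Indices start at 0, so the root written
   2 eps_n in the usual numbering is [Long i] for the i with i.+1 = n. *)
Inductive posroot (n : nat) : Type :=
  | Long of 'I_n
  | Sum of ltpair n
  | Diff of ltpair n.
Arguments Long {n} i.
Arguments Sum {n} ij.
Arguments Diff {n} ij.

Section PosrootFinite.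
Variable n : nat.

Definition posroot_enc (a : posroot n) : 'I_n + (ltpair n + ltpair n) :=
  match a with
  | Long i => inl i
  | Sum ij => inr (inl ij)
  | Diff ij => inr (inr ij)
  end.

Definition posroot_dec (s : 'I_n + (ltpair n + ltpair n)) : posroot n :=
  match s with
  | inl i => Long i
  | inr (inl ij) => Sum ij
  | inr (inr ij) => Diff ij
  end.

Lemma posroot_encK : cancel posroot_enc posroot_dec.
Proof. by case. Qed.

HB.instance Definition _ := Finite.copy (posroot n) (can_type posroot_encK).

End PosrootFinite.

Definition eps (n : nat) (i : 'I_n) : 'rV[rat]_n := delta_mx 0 i.

(* All roots have integral coordinates, so Q^n with the standard inner product
   is used in place of R^n. *)
Definition rootvec (n : nat) (a : posroot n) : 'rV[rat]_n :=
  match a with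
  | Long i => eps i *+ 2
  | Sum ij => eps (val ij).1 + eps (val ij).2
  | Diff ij => eps (val ij).1 - eps (val ij).2
  end.

Lemma rootvec_inj (n : nat) : injective (@rootvec n).
Proof.
move=> a b /rowP H.
have {}H k : rootvec a 0 k = rootvec b 0 k by exact: H.
case: a b H => [i|[[i j] /= ij]|[[i j] /= ij]] [k|[[k l] /= kl]|[[k l] /= kl]] /= H.
all: have := H i; have := H k.
all: try (have := H j); try (have := H l); clear H.
all: rewrite ?(mxE, mulr2n) /= ?eqxx /=.
all: try have -> : (i == j) = false by exact: ltn_eqF.
all: try have -> : (j == i) = false by exact: gtn_eqF.
all: try have -> : (k == l) = false by exact: ltn_eqF.
all: try have -> : (l == k) = false by exact: gtn_eqF.
all: try (case: (eqVneq i k) => [?|?]; first subst k).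
all: try (case: (eqVneq j l) => [?|?]; first subst l).
all: try (case: (eqVneq i l) => [?|?]; first subst l).
all: try (case: (eqVneq j k) => [?|?]; first subst k).
all: rewrite ?eqxx /= ?mulr1n ?mulr0n.
all: try by move=> *; exfalso; lra.
all: try by rewrite (bool_irrelevance ij kl).
all: try by move=> *; exfalso; lia.
all: try by [].
Qed.

Definition inner (n : nat) (u v : 'rV[rat]_n) : rat := \sum_(i < n) u 0 i * v 0 i.

Definition pairwise_orthogonal (n : nat) (D : {set posroot n}) : bool :=
  [forall a in D, forall b in D,
     (a != b) ==> (inner (rootvec a) (rootvec b) == 0)].

Definition Dreg (n : nat) : {set posroot n} :=
  [set a | match a with
           | Long _ => true
           | Sum ij => (val ij).1.+1 == (val ij).2 :> nat
           | Diff _ => false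
           end].

Definition max_orthogonal (n : nat) (D : {set posroot n}) : bool :=
  maxset (fun E : {set posroot n} => (E \subset Dreg n) && pairwise_orthogonal E) D.

Definition is_last_long (n : nat) (a : posroot n) : bool :=
  if a is Long i then i.+1 == n else false.

(* The indices 1, ..., n, -n, ..., -1 are listed in this order by 'I_(n + n). *)
Definition pos (n : nat) (i : 'I_n) : 'I_(n + n) := lshift n i.
Definition neg (n : nat) (i : 'I_n) : 'I_(n + n) := rshift n (rev_ord i).

Lemma fact_neq0 (F : finFieldType) (p m k : nat) :
  p \in [pchar F] -> (m <= p)%N -> (k < m)%N -> k`!%:R != 0 :> F.
Proof.
move=> cp mp km; rewrite -(dvdn_pcharf cp).
have pp := pcharf_prime cp.
elim: k km => [|k IH] km; first by rewrite dvdn1 gtn_eqF // prime_gt1.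
rewrite factS Euclid_dvdM // negb_or IH ?andbT; last by lia.
by apply/negP => /dvdn_leq; lia.
Qed.

Lemma truncated_exp_mulN (F : finFieldType) (p m N : nat) (x : 'M[F]_N) :
  p \in [pchar F] -> (0 < m <= p)%N -> (forall k, (m <= k)%N -> x ^+ k = 0) ->
  (\sum_(i < m) (i`!%:R)^-1 *: x ^+ i) *m (\sum_(i < m) (i`!%:R)^-1 *: (- x) ^+ i) = 1.
Proof.
move=> cp /andP[m0 mp] x0.
pose c i j : F := (i`!%:R)^-1 * (j`!%:R)^-1 * (-1) ^+ j.
rewrite mulmx_suml.
transitivity (\sum_(0 <= i < m) \sum_(0 <= k < m | (i <= k)%N) c i (k - i)%N *: x ^+ k).
  rewrite big_mkord; apply: eq_bigr => i _.
  have im := ltn_ord i.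
  rewrite mulmx_sumr (eq_bigr (fun j : 'I_m => c i j *: x ^+ (i + j))); last first.
    move=> j _; have -> : (- x) ^+ j = (-1) ^+ j *: x ^+ j.
      elim: (val j) => [|k IH]; first by rewrite !expr0 scale1r.
      by rewrite !exprS IH mulN1r mulNr scaleNr scalemxAr.
    by rewrite -scalemxAl -!scalemxAr !scalerA exprD /c mulrA.
  have le_im : (i <= m)%N by exact: ltnW.
  rewrite -(big_mkord xpredT (fun j => c i j *: x ^+ (i + j))).
  rewrite (@big_cat_nat _ _ _ (m - i)) ?leq_subr //= [X in _ + X]big_nat_cond.
  rewrite [X in _ + X]big1 ?addr0 => [|j]; last first.
    by case/andP=> /andP[mij _] _; rewrite x0 ?scaler0 //; lia.
  rewrite [RHS](@big_cat_nat _ _ _ i) //= [X in _ = X + _]big_nat_cond.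
  rewrite [X in _ = X + _]big1 ?add0r => [|k]; last first.
    by case/andP=> /andP[_ ki] ik; lia.
  rewrite -[X in _ = \sum_(X <= _ < _ | _) _]add0n big_addn [RHS]big_mkcond /=.
  by apply: eq_bigr => k _; rewrite leq_addl addnK addnC.
have c0 k : (k < m)%N -> \sum_(i < k.+1) c i (k - i)%N = (k == 0%N)%:R.
  move=> km; have nzf l : (l <= k)%N -> l`!%:R != 0 :> F.
    by move=> lk; apply: (fact_neq0 cp mp); lia.
  have := exprDn (-1 : F) 1 k; rewrite addNr expr0n => E.
  have -> : (k == 0%N)%:R = (k`!%:R)^-1 * (k == 0%N)%:R :> F.
    by case: eqP => [->|_]; rewrite ?mulr0 // fact0 invr1 mulr1.
  rewrite E mulr_sumr; apply: eq_bigr => i _.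
  have ik : (i <= k)%N by rewrite -ltnS.
  rewrite expr1n mulr1 -mulr_natr /c -(bin_fact ik) !natrM.
  have bin0 : 'C(k, i)%:R != 0 :> F.
    by have := nzf k (leqnn k); rewrite -(bin_fact ik) natrM mulf_eq0 => /norP[].
  field; rewrite bin0 !nzf //; lia.
rewrite (exchange_big_dep_nat xpredT) //=.
rewrite (eq_big_nat _ _ (F2 := fun k => (k == 0%N)%:R *: x ^+ k)) => [|k /andP[_ km]].
  rewrite big_ltn // scale1r expr0 big_nat_cond big1 ?addr0 // => k.
  by case/andP=> /andP[k0 _] _; rewrite gtn_eqF // scale0r.
rewrite -scaler_suml; congr (_ *: _); rewrite -(c0 k km).
rewrite (@big_cat_nat _ _ _ k.+1) //= [X in _ + X]big_nat_cond.
rewrite [X in _ + X]big1 ?addr0 => [|j]; last first.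
  by case/andP=> /andP[kj _]; lia.
rewrite -(big_mkord xpredT (fun i => c i (k - i)%N)) big_nat_cond [RHS]big_nat_cond.
by apply: eq_bigl => j; rewrite andbT; case: (j < k.+1)%N (ltnS j k) => <-; rewrite ?andbF.
Qed.

Section Coadjoint.
Variables (F : finFieldType) (n : nat).

Definition rootelt (a : posroot n) : 'M[F]_(n + n) :=
  match a with
  | Long i => delta_mx (neg i) (pos i)
  | Diff ij => let: (i, j) := val ij in
      delta_mx (pos j) (pos i) - delta_mx (neg i) (neg j)
  | Sum ij => let: (i, j) := val ij in
      delta_mx (neg j) (pos i) + delta_mx (neg i) (pos j)
  end.

Definition rootbasis : #|{: posroot n}|.-tuple 'M[F]_(n + n) :=
  [tuple of codom rootelt].

Definition ualg : {vspace 'M[F]_(n + n)} := <<rootbasis>>%VS.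

Definition mexp (x : 'M[F]_(n + n)) : 'M[F]_(n + n) :=
  \sum_(i < n + n) (i`!%:R)^-1 *: x ^+ i.

Definition Ugrp : {set 'M[F]_(n + n)} := [set mexp x | x in ualg].

Definition udual : predArgType := finvect_type 'Hom(subvs_of ualg, F^o).

Definition rootdual (a : posroot n) : udual :=
  linfun ((coord rootbasis (enum_rank a) : 'M[F]_(n + n) -> F^o) \o vsval).

(* For g in U and x in u the matrix g^-1 x g lies in u (lemma [conj_ualg]), so
   that [vsproj] only changes its type. *)
Definition coad (g : 'M[F]_(n + n)) (f : udual) : udual :=
  linfun (f \o vsproj ualg \o mulmxr g \o mulmx (invmx g) \o vsval).

Definition coad_orbit (f : udual) : {set udual} := [set coad g f | g in Ugrp].

Definition has_dim (O : {set udual}) (d : nat) : Prop := #|O| = (#|F| ^ d)%N.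

Definition max_dim (O : {set udual}) : Prop :=
  exists2 d, has_dim O d &
    forall f : udual, exists2 d', has_dim (coad_orbit f) d' & (d' <= d)%N.

(* The family (xi_b)_{b in D} is given by a function whose values outside D are
   not used. *)
Definition form_of (D : {set posroot n}) (xi : posroot n -> F) : udual :=
  \sum_(b in D) xi b *: rootdual b.

Definition admissible (D : {set posroot n}) (xi : posroot n -> F) : Prop :=
  max_orthogonal D /\ forall b, b \in D -> ~~ is_last_long b -> xi b != 0.

Lemma pos_neg (i j : 'I_n) : (pos i == neg j) = false.
Proof. exact: eq_lrshift. Qed.

Lemma neg_pos (i j : 'I_n) : (neg i == pos j) = false.
Proof. exact: eq_rlshift. Qed.

Lemma pos_eq (i j : 'I_n) : (pos i == pos j) = (i == j).
Proof. exact: eq_lshift. Qed.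

Lemma neg_eq (i j : 'I_n) : (neg i == neg j) = (i == j).
Proof. by rewrite eq_rshift (inj_eq rev_ord_inj). Qed.

Definition leadpos (a : posroot n) : 'I_(n + n) * 'I_(n + n) :=
  match a with
  | Long i => (neg i, pos i)
  | Diff ij => (pos (val ij).2, pos (val ij).1)
  | Sum ij => (neg (val ij).2, pos (val ij).1)
  end.

Lemma rootelt_lead (a b : posroot n) :
  rootelt b (leadpos a).1 (leadpos a).2 = (b == a)%:R.
Proof.
have enc : injective (@posroot_enc n) by apply: can_inj; exact: posroot_encK.
case: a => [i|[[i j] /= ij]|[[i j] /= ij]];
  case: b => [k|[[k l] /= kl]|[[k l] /= kl]] /=;
  rewrite !mxE /= ?(pos_neg, neg_pos, pos_eq, neg_eq, andbF, addr0, subr0, subrr) //.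
- by rewrite andbb eq_sym.
- have E : (i == l) && (i == k) = false by apply/negP => /andP[/eqP e1 /eqP e2]; subst; lia.
  by rewrite [(i == k) && _]andbC E addr0.
- by have -> : (j == k) && (i == k) = false by apply/negP => /andP[/eqP e1 /eqP e2]; subst; lia.
- have -> : (j == k) && (i == l) = false by apply/negP => /andP[/eqP e1 /eqP e2]; subst; lia.
  by rewrite addr0 andbC -(inj_eq enc) [in RHS]eq_sym.
- by rewrite andbC -(inj_eq enc) [in RHS]eq_sym.
Qed.

Lemma rootelt_free : free rootbasis.
Proof.
apply/freeP => c Hc i.
move/matrixP/(_ (leadpos (enum_val i)).1 (leadpos (enum_val i)).2): Hc.
rewrite summxE mxE (bigD1 i) //= big1 => [|j ji].
  by rewrite addr0 mxE nth_codom rootelt_lead eqxx mulr1.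
rewrite mxE nth_codom rootelt_lead (inj_eq enum_val_inj) (negPf ji).
by rewrite mulr0.
Qed.

Lemma mem_rootelt (a : posroot n) : rootelt a \in ualg.
Proof. by rewrite /ualg memv_span //; exact: codom_f. Qed.

Lemma rootdualE (a b : posroot n) :
  rootdual a (vsproj ualg (rootelt b)) = (a == b)%:R.
Proof.
rewrite /rootdual lfunE /= vsprojK ?mem_rootelt //.
have -> : rootelt b = rootbasis`_(enum_rank b) by rewrite nth_codom enum_rankK.
by rewrite coord_free ?rootelt_free // (inj_eq enum_rank_inj) eq_sym.
Qed.

Definition isgn (a : 'I_(n + n)) : F := (-1) ^+ (n <= a)%N.

Lemma isgn_pos (i : 'I_n) : isgn (pos i) = 1.
Proof. by rewrite /isgn /= leqNgt ltn_ord. Qed.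

Lemma isgn_neg (i : 'I_n) : isgn (neg i) = -1.
Proof. by rewrite /isgn /= leq_addr expr1. Qed.

Lemma isgn_sq (a : 'I_(n + n)) : isgn a * isgn a = 1.
Proof. by rewrite -expr2 /isgn sqrr_sign. Qed.

Lemma rev_pos (i : 'I_n) : rev_ord (pos i) = neg i.
Proof. by apply: val_inj => /=; have := ltn_ord i; lia. Qed.

Lemma rev_neg (i : 'I_n) : rev_ord (neg i) = pos i.
Proof. by rewrite -rev_pos rev_ordK. Qed.

Variant index_spec : 'I_(n + n) -> Type :=
  | IndexPos i : index_spec (pos i)
  | IndexNeg i : index_spec (neg i).

Lemma indexP (a : 'I_(n + n)) : index_spec a.
Proof.
rewrite -(splitK a); case: (split a) => [i|i] /=; first exact: IndexPos.
by rewrite -[i]rev_ordK; apply: IndexNeg.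
Qed.

(* The anti-automorphism of matrices whose -1 eigenspace is sp_2n. *)
Definition spinv (A : 'M[F]_(n + n)) : 'M[F]_(n + n) :=
  \matrix_(a, b) (isgn a * isgn b * A (rev_ord b) (rev_ord a)).

Definition lower (k : nat) (A : 'M[F]_(n + n)) : Prop :=
  forall a b : 'I_(n + n), (a < b + k)%N -> A a b = 0.

Lemma spinvD A B : spinv (A + B) = spinv A + spinv B.
Proof. by apply/matrixP => a b; rewrite !mxE mulrDr. Qed.

Lemma spinvZ c A : spinv (c *: A) = c *: spinv A.
Proof. by apply/matrixP => a b; rewrite !mxE mulrCA. Qed.

Lemma spinv0 : spinv 0 = 0.
Proof. by apply/matrixP => a b; rewrite !mxE mulr0. Qed.

Lemma spinv_sum I (r : seq I) (P : pred I) (E : I -> 'M[F]_(n + n)) :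
  spinv (\sum_(i <- r | P i) E i) = \sum_(i <- r | P i) spinv (E i).
Proof. exact: (big_morph _ spinvD spinv0). Qed.

Lemma spinv1 : spinv 1 = 1.
Proof.
apply/matrixP => a b; rewrite !mxE (inj_eq rev_ord_inj) eq_sym.
by case: eqP => [->|_]; rewrite ?mulr0 // isgn_sq mulr1.
Qed.

Lemma spinvM A B : spinv (A *m B) = spinv B *m spinv A.
Proof.
apply/matrixP => a b; rewrite !mxE mulr_sumr (reindex_inj rev_ord_inj) /=.
apply: eq_bigr => c _; rewrite !mxE.
have := isgn_sq c; set s := isgn c => Hs.
by rewrite -[LHS]mul1r -Hs; ring.
Qed.

Lemma spinvX A k : spinv (A ^+ k) = spinv A ^+ k.
Proof.
elim: k => [|k IH]; first by rewrite !expr0 spinv1.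
by rewrite exprS exprSr -IH; exact: spinvM.
Qed.

Lemma lowerM k l A B : lower k A -> lower l B -> lower (k + l) (A *m B).
Proof.
move=> lA lB a b ab; rewrite mxE big1 // => c _.
case: (ltnP a (c + k)) => ac; first by rewrite lA ?mul0r.
by rewrite (lB c b) ?mulr0 //; lia.
Qed.

Lemma lowerW k l A : (l <= k)%N -> lower k A -> lower l A.
Proof. by move=> kl lA a b ab; apply: lA; lia. Qed.

Lemma lower1 : lower 0 1.
Proof. by move=> a b ab; rewrite mxE -val_eqE /= ltn_eqF //; lia. Qed.

Lemma lowerX k A : lower 1 A -> lower k (A ^+ k).
Proof.
move=> lA; elim: k => [|k IH]; first by rewrite expr0; exact: lower1.
by rewrite exprS -add1n; exact: lowerM.
Qed.

Lemma lower_nilp k A : (n + n <= k)%N -> lower k A -> A = 0.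
Proof.
move=> mk lA; apply/matrixP => a b; rewrite mxE lA //.
by have := ltn_ord a; lia.
Qed.

Lemma lower_sum k I (r : seq I) (P : pred I) (E : I -> 'M[F]_(n + n)) :
  (forall i, P i -> lower k (E i)) -> lower k (\sum_(i <- r | P i) E i).
Proof. by move=> lE a b ab; rewrite summxE big1 // => i /lE ->. Qed.

Lemma lowerZ k c A : lower k A -> lower k (c *: A).
Proof. by move=> lA a b ab; rewrite mxE lA ?mulr0. Qed.

Lemma lower_rootelt a : lower 1 (rootelt a).
Proof.
move=> c d.
case: a => [i|[[i j] /= ij]|[[i j] /= ij]];
  case: (indexP c) => k; case: (indexP d) => l /= cd; rewrite !mxE;
  rewrite ?(pos_neg, neg_pos, pos_eq, neg_eq) ?(andbF, addr0, subr0, add0r) //=.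
all: have := ltn_ord k; have := ltn_ord l; move=> ln kn.
all: repeat case: eqP => [?|_] //; subst; rewrite ?(addr0, subr0, oppr0) //.
all: by exfalso; lia.
Qed.

Lemma spinv_rootelt a : spinv (rootelt a) = - rootelt a.
Proof.
apply/matrixP => c d.
by case: a => [i|[[i j] /= ij]|[[i j] /= ij]];
  case: (indexP c) => k; case: (indexP d) => l /=; rewrite !mxE;
  rewrite ?(rev_pos, rev_neg, isgn_pos, isgn_neg);
  rewrite ?(pos_neg, neg_pos, pos_eq, neg_eq) ?(andbF, andbT) /=;
  repeat case: eqP => _ /=; ring.
Qed.

Lemma spinvN A : spinv (- A) = - spinv A.
Proof. by rewrite -!scaleN1r spinvZ. Qed.

Lemma ualg_sub (x : 'M[F]_(n + n)) : x \in ualg -> lower 1 x /\ spinv x = - x.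
Proof.
move=> /coord_span ->; split.
  by apply: lower_sum => i _; apply: lowerZ; rewrite nth_codom; exact: lower_rootelt.
rewrite spinv_sum -sumrN; apply: eq_bigr => i _.
by rewrite spinvZ nth_codom spinv_rootelt scalerN.
Qed.

Lemma sub_ualg (x : 'M[F]_(n + n)) : lower 1 x -> spinv x = - x -> x \in ualg.
Proof.
pose z := \sum_a x (leadpos a).1 (leadpos a).2 *: rootelt a.
have zu : z \in ualg by apply: memv_suml => a _; apply: memvZ; exact: mem_rootelt.
move=> lx sx; suff -> : x = z by [].
have [lz sz] := ualg_sub zu.
have zx a : (x - z) (leadpos a).1 (leadpos a).2 = 0.
  rewrite !mxE summxE (bigD1 a) //= big1 => [|b ba].
    by rewrite mxE rootelt_lead eqxx mulr1 addr0 subrr.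
  by rewrite mxE rootelt_lead (negPf ba) mulr0.
have ly : lower 1 (x - z) by move=> a b ab; rewrite !mxE lx // lz // subrr.
have sy : spinv (x - z) = - (x - z) by rewrite spinvD spinvN sx sz opprD.
move: (x - z) ly sy zx (subr0_eq (x := x) (y := z)) => y ly sy zy; apply.
have mir a b : y (rev_ord b) (rev_ord a) = 0 -> y a b = 0.
  move=> yba; move/matrixP/(_ a b): sy; rewrite !mxE yba mulr0.
  by move/eqP; rewrite eq_sym oppr_eq0 => /eqP.
apply/matrixP => a b; rewrite mxE.
case: (ltnP a (b + 1)) => [/ly //|ba].
case: (indexP a) ba => i; case: (indexP b) => j /= ba.
- have ji : (j < i)%N by lia.
  exact: (zy (Diff (exist _ (j, i) ji : ltpair n))).
- by have := ltn_ord i; lia.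
- case: (ltngtP i j) => ij.
  + by apply: mir; rewrite rev_pos rev_neg; exact: (zy (Sum (exist _ (i, j) ij : ltpair n))).
  + exact: (zy (Sum (exist _ (j, i) ij : ltpair n))).
  + by move/val_inj: ij => ->; exact: (zy (Long j)).
- apply: mir; rewrite !rev_neg.
  have ij : (i < j)%N by have := ltn_ord i; have := ltn_ord j; lia.
  exact: (zy (Diff (exist _ (i, j) ij : ltpair n))).
Qed.

Lemma mexp_mulN (p : nat) (x : 'M[F]_(n + n)) :
  p \in [pchar F] -> (2 * n <= p)%N -> x \in ualg -> mexp x *m mexp (- x) = 1.
Proof.
move=> charp np /ualg_sub[lx _]; case: (posnP n) => [n0|n_gt0].
  by apply/matrixP => a; have := ltn_ord a; lia.
apply: (truncated_exp_mulN charp); first by lia.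
by move=> k mk; apply: (lower_nilp mk); exact: lowerX.
Qed.

Lemma conj_ualg (p : nat) (g x : 'M[F]_(n + n)) :
  p \in [pchar F] -> (2 * n <= p)%N -> g \in Ugrp -> x \in ualg ->
  invmx g *m x *m g \in ualg.
Proof.
move=> charp np /imsetP[y yu ->] xu.
have Nyu : - y \in ualg by rewrite memvN.
have ymul := mexp_mulN charp np yu.
have inv : invmx (mexp y) = mexp (- y).
  by have [] := mulmx1_unit ymul => u _; rewrite -[RHS](mulKmx u) ymul mulmx1.
have [ly sy] := ualg_sub yu; have [lNy _] := ualg_sub Nyu.
have [lx sx] := ualg_sub xu.
have lexp z : lower 1 z -> lower 0 (mexp z).
  move=> lz; apply: lower_sum => i _; apply: lowerZ.
  by apply: (@lowerW i) => //; exact: lowerX.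
have sexp z : spinv (mexp z) = mexp (spinv z).
  by rewrite spinv_sum; apply: eq_bigr => i _; rewrite spinvZ spinvX.
rewrite inv; apply: sub_ualg.
  rewrite -[1%N]/(0 + 1 + 0)%N.
  by apply: lowerM; [apply: lowerM => // |]; exact: lexp.
rewrite !spinvM !sexp spinvN sy opprK sx.
by rewrite mulNmx mulmxN mulmxA.
Qed.

Lemma coadE (g : 'M[F]_(n + n)) (f : udual) (x : subvs_of ualg) :
  coad g f x = f (vsproj ualg (invmx g *m vsval x *m g)).
Proof. by rewrite lfunE. Qed.

End Coadjoint.

(* Main.v *)
Require Import Defs.
From HB Require Import structures.
From mathcomp Require Import all_boot all_order all_fingroup all_algebra all_field.
From mathcomp Require Import ring lra zify.

(** Write an element of [u] as a pair [(a, s)] of its strictly lower triangular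
    block [a] and its symmetric block [s], and a linear form on [u] as
    [f (a, s) = tr (L a) + tr (B s)], where [B] is symmetric and [L] matters only
    strictly above the diagonal. An element of [U] is a pair [(k, s)] with [k]
    lower unitriangular and [s] symmetric; it sends [B] to [B' = k B k^T] and [L]
    to [k L k^-1 - 2 B' s] ([spart_coad], [upart_coad]).

    Size of the orbits. An orbit consists of pairs [(L, B)] with [B] in a single
    congruence orbit, so it has at most [N T] elements, where [N] is the number
    of unitriangular [k] and [T] the number of strictly upper triangular [L].
    Equality forces [k |-> k B k^T] to be injective, that is, [a B + B a^T = 0]
    to have no strictly lower triangular solution but 0 ([max_free]). In the
    other direction, if the strictly upper part of [B s] takes every value for
    symmetric [s], then the translations by [B s] fill the whole [L] direction;
    by duality for the trace form [k |-> k B k^T] is also injective, and the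
    orbit has exactly [N T] elements ([low_solvable_card]). That every orbit has
    size a power of [q] follows from the Cayley transform, which maps the
    stabiliser of [f] onto the radical of the form [(x, y) |-> f [x, y]]
    ([coad_fix], [coad_orbit_card]).

    Normal forms. A maximal orthogonal subset [D] is a tiling of the indices by
    points [2 eps_i] and dominoes [eps_i + eps_(i+1)] ([max_orthogonalP]), and
    for an admissible form [L = 0] and [B] is supported on the involution given
    by the tiling ([admissible_nf]). For such a [B] the equations for [B s] are
    triangular enough to be solved directly ([nf_low_solvable]), so admissible
    forms lie on orbits of maximal dimension. Conversely, injectivity of
    [k |-> k B k^T] guarantees at each stage of a symmetric elimination that the
    pivot lies on the diagonal or next to it ([free_pivot]), so [B] is congruent
    to a normal form ([nf_exists]) and a translation then removes [L]
    ([max_dim_form]). Two congruent normal forms are equal by the uniqueness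
    argument of the Bruhat decomposition ([congr_supported_eq]).

    The case [n = 1], where the characteristic can be 2, is treated apart: [U]
    acts trivially there. *)

Set Implicit Arguments.
Unset Strict Implicit.
Unset Printing Implicit Defensive.

Import GRing.Theory.
Local Open Scope ring_scope.

(** * Triangular matrices and the Cayley transform *)
Section Low.
Variables (F : fieldType) (m : nat).
Implicit Types A B g h : 'M[F]_m.

(** The filtration by distance below the diagonal is needed for blocks of size
    [n] as well as in size [n + n], and as a boolean, so that the unitriangular
    matrices form a finite set that can be counted. *)
Definition low (k : nat) A : bool :=
  [forall a : 'I_m, [forall b : 'I_m, (a < b + k)%N ==> (A a b == 0)]].

Lemma lowP k A : reflect (forall a b : 'I_m, (a < b + k)%N -> A a b = 0) (low k A).
Proof.
apply: (iffP forallP) => [H a b ab|H a]; last first.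
  by apply/forallP => b; apply/implyP => ab; rewrite H.
by move: (H a) => /forallP/(_ b)/implyP/(_ ab)/eqP.
Qed.

Lemma lowW k l A : (l <= k)%N -> low k A -> low l A.
Proof. by move=> kl /lowP lA; apply/lowP => a b ab; apply: lA; lia. Qed.

Lemma lowD k A B : low k A -> low k B -> low k (A + B).
Proof. by move=> /lowP lA /lowP lB; apply/lowP => a b ab; rewrite mxE lA // lB // addr0. Qed.

Lemma lowN k A : low k A -> low k (- A).
Proof. by move=> /lowP lA; apply/lowP => a b ab; rewrite mxE lA // oppr0. Qed.

Lemma lowB k A B : low k A -> low k B -> low k (A - B).
Proof. by move=> lA lB; apply: lowD => //; apply: lowN. Qed.

Lemma lowZ k c A : low k A -> low k (c *: A).
Proof. by move=> /lowP lA; apply/lowP => a b ab; rewrite mxE lA // mulr0. Qed.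

Lemma lowM k l A B : low k A -> low l B -> low (k + l) (A *m B).
Proof.
move=> /lowP lA /lowP lB; apply/lowP => a b ab; rewrite mxE big1 // => c _.
case: (ltnP a (c + k)) => ac; first by rewrite lA ?mul0r.
by rewrite (lB c b) ?mulr0 //; lia.
Qed.

Lemma low_scalar c : low 0 c%:M.
Proof. by apply/lowP => a b ab; rewrite mxE -val_eqE /= ltn_eqF //; lia. Qed.

Lemma low_nilp k A : (m <= k)%N -> low k A -> A = 0.
Proof.
move=> mk /lowP lA; apply/matrixP => a b; rewrite mxE lA //.
by have := ltn_ord a; lia.
Qed.

Lemma low_unit A : low 0 A -> (forall a, A a a != 0) -> A \in unitmx.
Proof.
move=> /lowP lA dA; rewrite unitmxE unitfE det_trig ?prodf_seq_neq0.
  by apply/allP => a _; rewrite dA.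
by apply/is_trig_mxP => a b ab; apply: lA; lia.
Qed.

(** Dividing on the right by an invertible triangular matrix preserves the
    filtration: the columns of the quotient are determined from the last one
    to the first. *)
Lemma low_divr k A B :
  low 0 B -> (forall a, B a a != 0) -> low k (A *m B) -> low k A.
Proof.
move=> /lowP lB dB /lowP lAB; apply/lowP => a b.
move: {2}(m - b)%N (leqnn (m - b)) => d.
elim: d b => [|d IH] b bd ab; first by have := ltn_ord b; lia.
have := lAB a b ab; rewrite mxE (bigD1 b) //= big1 => [|c cb].
  by rewrite addr0 => /eqP; rewrite mulf_eq0 (negPf (dB b)) orbF => /eqP.
case: (ltngtP b c) => bc; last by move/val_inj: bc cb => ->; rewrite eqxx.
  by rewrite IH ?mul0r //; have := ltn_ord c; lia.
by rewrite lB ?mulr0 //; lia.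
Qed.

Definition symm A : bool := A^T == A.

Definition unip g : bool := low 1 (g - 1%:M).

Lemma unipE g : unip g -> g = 1%:M + (g - 1%:M).
Proof. by rewrite addrC subrK. Qed.

Lemma unip_low g : unip g -> low 0 g.
Proof.
by move=> ug; rewrite (unipE ug) lowD ?low_scalar //; apply: lowW ug.
Qed.

Lemma unip_diag g a : unip g -> g a a = 1.
Proof.
move=> /lowP/(_ a a); rewrite !mxE eqxx => H.
by apply/eqP; rewrite -subr_eq0 H //; lia.
Qed.

Lemma unip_diag_neq0 g a : unip g -> g a a != 0.
Proof. by move=> ug; rewrite unip_diag ?oner_eq0. Qed.

Lemma unip_unit g : unip g -> g \in unitmx.
Proof.
by move=> ug; apply: low_unit => [|a]; [exact: unip_low | exact: unip_diag_neq0].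
Qed.

Lemma unip1 : unip 1%:M.
Proof. by apply/lowP => a b _; rewrite subrr mxE. Qed.

Lemma unipD1 A : low 1 A -> unip (1%:M + A).
Proof. by move=> lA; rewrite /unip addrAC subrr add0r. Qed.

Lemma unipB1 A : low 1 A -> unip (1%:M - A).
Proof. by move=> lA; apply: unipD1; apply: lowN. Qed.

Lemma unipM g h : unip g -> unip h -> unip (g *m h).
Proof.
move=> ug uh; rewrite /unip.
have -> : g *m h - 1%:M = (g - 1%:M) *m h + (h - 1%:M).
  by rewrite mulmxBl mul1mx addrA subrK.
by apply: lowD => //; rewrite -[1%N]addn0; apply: lowM => //; exact: unip_low.
Qed.

Lemma unipV g : unip g -> unip (invmx g).
Proof.
move=> ug; apply: (@low_divr _ _ g) => [|a|]; first exact: unip_low.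
  exact: unip_diag_neq0.
by rewrite mulmxBl mulVmx ?unip_unit // mul1mx -opprB lowN.
Qed.

Lemma low_conj k g h A : unip g -> unip h -> low k A -> low k (g *m A *m h).
Proof.
move=> /unip_low lg /unip_low lh lA; rewrite -[k]addn0 -[k]add0n.
by do 2!apply: lowM => //.
Qed.

(** The Cayley transform [(g - 1) (g + 1)^-1] replaces the logarithm: it needs
    only the prime 2 to be invertible, and it turns conjugation invariance under
    a unipotent element into a linear condition. *)
Definition cayley g := (g - 1%:M) *m invmx (g + 1%:M).

Hypothesis two_neq0 : 2%:R != 0 :> F.

Lemma unipD1_diag g a : unip g -> (g + 1%:M) a a != 0.
Proof. by move=> ug; rewrite !mxE unip_diag // eqxx -[_ + _]/(2%:R). Qed.

Lemma unipD1_unit g : unip g -> g + 1%:M \in unitmx.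
Proof.
move=> ug; apply: low_unit => [|a]; last exact: unipD1_diag.
by apply: lowD; [exact: unip_low | exact: low_scalar].
Qed.

Lemma cayleyK g : unip g -> cayley g *m (g + 1%:M) = g - 1%:M.
Proof. by move=> ug; rewrite -mulmxA mulVmx ?mulmx1 ?unipD1_unit. Qed.

Lemma cayley_low g : unip g -> low 1 (cayley g).
Proof.
move=> ug; apply: (@low_divr _ _ (g + 1%:M)) => [|a|]; last by rewrite cayleyK.
  by apply: lowD; [exact: unip_low | exact: low_scalar].
exact: unipD1_diag.
Qed.

Lemma cayley_mull g : unip g -> (1%:M - cayley g) *m g = 1%:M + cayley g.
Proof.
move=> ug; have := cayleyK ug; rewrite mulmxDr mulmx1 mulmxBl mul1mx => E.
by apply/eqP; rewrite subr_eq -addrA [cayley g + _]addrC E addrC subrK.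
Qed.

Lemma cayley_comm g : unip g -> cayley g *m g = g *m cayley g.
Proof.
move=> ug; have u1 := unipD1_unit ug.
suff : (g + 1%:M) *m cayley g = cayley g *m (g + 1%:M).
  by rewrite mulmxDl mulmxDr mul1mx mulmx1 => /addIr.
rewrite cayleyK // /cayley mulmxA.
have -> : (g + 1%:M) *m (g - 1%:M) = (g - 1%:M) *m (g + 1%:M).
  by rewrite mulmxDl mul1mx [RHS]mulmxDr mulmx1 mulmxBl mulmxBr mul1mx mulmx1.
by rewrite -mulmxA mulmxV // mulmx1.
Qed.

Lemma cayley_mulr g : unip g -> g *m (1%:M - cayley g) = 1%:M + cayley g.
Proof.
by move=> ug; rewrite mulmxBr mulmx1 -cayley_comm // -cayley_mull // mulmxBl mul1mx.
Qed.

Lemma cayley_inj g h : unip g -> unip h -> cayley g = cayley h -> g = h.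
Proof.
move=> ug uh E; have u1 : 1%:M - cayley g \in unitmx.
  by apply: unip_unit; apply: unipB1; exact: cayley_low.
by apply: (can_inj (mulKmx u1)); rewrite cayley_mull // E cayley_mull.
Qed.

End Low.

(** * The symplectic unitriangular group *)
Section Group.
Variables (F : finFieldType) (n p : nat).
Implicit Types (x y z g h : 'M[F]_(n + n)) (f : udual F n).

Lemma ualgP x : reflect (low 1 x /\ spinv x = - x) (x \in ualg F n).
Proof.
apply: (iffP idP) => [/ualg_sub[/lowP lx sx]|[/lowP lx sx]]; first by split.
exact: sub_ualg.
Qed.

Lemma pow_sub_low k i x y :
  low 1 x -> low 1 y -> low k (x - y) -> low (k + i) (x ^+ i.+1 - y ^+ i.+1).
Proof.
move=> lx ly lxy; elim: i => [|i IH]; first by rewrite addn0.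
have -> : x ^+ i.+2 - y ^+ i.+2 = x *m (x ^+ i.+1 - y ^+ i.+1) + (x - y) *m y ^+ i.+1.
  by rewrite exprS [y ^+ i.+2]exprS mulmxBr mulmxBl addrA subrK.
apply: lowD; first by rewrite addnS -add1n; apply: lowM.
apply: lowM => //; apply/lowP; apply: lowerX; exact/lowP.
Qed.

Hypothesis n_gt0 : (0 < n)%N.

(** The leading part of [mexp x - mexp y] for the filtration by distance to the
    diagonal is that of [x - y]. *)
Lemma mexp_inj : {in ualg F n &, injective (@mexp F n)}.
Proof.
move=> x y /ualgP[lx _] /ualgP[ly _] E.
have n1 : (1 < n + n)%N by lia.
have low_step k : low k (x - y) -> low k.+1 (x - y).
  move=> lk; have := subrr (mexp x); rewrite [X in _ - X]E /mexp -sumrB.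
  rewrite (bigD1 (Ordinal n1)) //= -[1`!]/1%N invr1 !scale1r !expr1 => /eqP.
  rewrite addr_eq0 => /eqP ->; apply: lowN; apply/lowP/lower_sum => -[i im].
  rewrite -val_eqE /= => i1; apply/lowP.
  rewrite -scalerBr; apply: lowZ; case: i i1 {im} => [|[|i]] // _.
    by rewrite !expr0 subrr; apply/lowP => a b _; rewrite mxE.
  by apply: (@lowW _ _ (k + i.+1)); [lia | exact: pow_sub_low].
have {}low_step k : low k (x - y).
  elim: k => [|k]; last exact: low_step.
  by apply: lowB; [apply: lowW lx | apply: lowW ly].
by apply/subr0_eq/(@low_nilp _ _ (n + n)).
Qed.

(** Unlike [Ugrp], an image of the exponential map, this set is visibly closed
    under products and inverses. *)
Definition sp_unip : {set 'M[F]_(n + n)} :=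
  [set g | unip g && (spinv g *m g == 1%:M)].

Lemma sp_unipP g : reflect (unip g /\ spinv g *m g = 1%:M) (g \in sp_unip).
Proof. by rewrite inE; apply: (iffP andP) => -[ug /eqP ?]; split=> //; apply/eqP. Qed.

Lemma sp_unip_invmx g : g \in sp_unip -> invmx g = spinv g.
Proof.
by case/sp_unipP=> ug E; rewrite -[RHS]mulmx1 -(mulmxV (unip_unit ug)) mulmxA E mul1mx.
Qed.

Lemma sp_unipM g h : g \in sp_unip -> h \in sp_unip -> g *m h \in sp_unip.
Proof.
case/sp_unipP=> ug sg /sp_unipP[uh sh]; apply/sp_unipP; split; first exact: unipM.
by rewrite spinvM -mulmxA [spinv g *m _]mulmxA sg mul1mx.
Qed.

Lemma sp_unipV g : g \in sp_unip -> invmx g \in sp_unip.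
Proof.
move=> Gg; have [ug sg] := sp_unipP _ Gg; apply/sp_unipP; split; first exact: unipV.
have gs : g *m spinv g = 1%:M by rewrite -sp_unip_invmx // mulmxV // unip_unit.
by rewrite sp_unip_invmx // -spinvM gs spinv1.
Qed.

Lemma sp_unip_conj g x :
  g \in sp_unip -> x \in ualg F n -> invmx g *m x *m g \in ualg F n.
Proof.
move=> Gg /ualgP[lx sx]; have [ug _] := sp_unipP _ Gg.
apply/ualgP; split; first exact: low_conj (unipV ug) ug lx.
have sV : spinv (invmx g) = g by rewrite -(sp_unip_invmx (sp_unipV Gg)) invmxK.
by rewrite !spinvM sV sx (sp_unip_invmx Gg) mulNmx mulmxN mulmxA.
Qed.

Hypotheses (charp : p \in [pchar F]) (np : (2 * n <= p)%N).

(** [spinv] reverses products and negates [u], so it inverts exponentials. *)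
Lemma mexp_sp_unip x : x \in ualg F n -> mexp x \in sp_unip.
Proof.
move=> xu; have [lx sx] := ualgP _ xu; apply/sp_unipP; split.
  have n1 : (0 < n + n)%N by lia.
  rewrite /unip /mexp (bigD1 (Ordinal n1)) //= fact0 invr1 scale1r expr0.
  rewrite addrAC subrr add0r; apply/lowP/lower_sum => -[i im].
  rewrite -val_eqE /= => i1; apply: lowerZ; apply: (@lowerW _ _ i); first by lia.
  by apply: lowerX; apply/lowP.
have -> : spinv (mexp x) = mexp (- x).
  by rewrite spinv_sum; apply: eq_bigr => i _; rewrite spinvZ spinvX sx.
by rewrite -[X in _ *m mexp X]opprK (mexp_mulN charp) ?memvN.
Qed.

Hypothesis two_neq0 : 2%:R != 0 :> F.

(** Applying [spinv] to [x (g + 1) = g - 1] and multiplying by [g] shows that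
    [spinv x] and [- x] have the same product with [g + 1]. *)
Lemma cayley_ualg g : g \in sp_unip -> cayley g \in ualg F n.
Proof.
move=> Gg; have [ug sg] := sp_unipP _ Gg; apply/ualgP; split; first exact: cayley_low.
set x := cayley g; have u1 := unipD1_unit two_neq0 ug.
have spg1 : spinv (g + 1%:M) = spinv g + 1%:M by rewrite spinvD spinv1.
have gsg : g *m spinv g = 1%:M by rewrite -sp_unip_invmx // mulmxV // unip_unit.
have E : (g + 1%:M) *m spinv x = 1%:M - g.
  have := congr1 (@spinv F n) (cayleyK two_neq0 ug).
  rewrite spinvM spinvD spinvD spinvN spinv1 -/x => /(congr1 (mulmx g)).
  by rewrite mulmxA mulmxDr gsg mulmxBr gsg !mulmx1 addrC.
apply: (can_inj (mulKmx u1)); rewrite E mulmxN.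
have -> : (g + 1%:M) *m x = x *m (g + 1%:M).
  by rewrite mulmxDr mulmxDl /x cayley_comm // mulmx1 mul1mx.
by rewrite cayleyK // opprB.
Qed.

Lemma cayley_sp_unip_inj : {in sp_unip &, injective (@cayley F (n + n))}.
Proof. by move=> g h /sp_unipP[ug _] /sp_unipP[uh _]; exact: cayley_inj. Qed.

(** The exponential map injects [u] into the group and the Cayley transform
    injects the group into [u]; both sets being finite, both maps are bijective.
    *)
Lemma UgrpE : Ugrp F n = sp_unip.
Proof.
apply/eqP; rewrite eqEcard; apply/andP; split.
  by apply/subsetP => _ /imsetP[x xu ->]; exact: mexp_sp_unip.
rewrite (card_in_imset mexp_inj) -(card_in_imset cayley_sp_unip_inj).
by apply/subset_leq_card/subsetP => _ /imsetP[g Gg ->]; exact: cayley_ualg.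
Qed.

Lemma card_sp_unip : #|sp_unip| = #|ualg F n|.
Proof. by rewrite -UgrpE (card_in_imset mexp_inj). Qed.

Lemma cayley_im : [set cayley g | g in sp_unip] = [set x in ualg F n].
Proof.
apply/eqP; rewrite eqEcard (card_in_imset cayley_sp_unip_inj) cardsE.
rewrite card_sp_unip leqnn andbT.
by apply/subsetP => _ /imsetP[g Gg ->]; rewrite inE cayley_ualg.
Qed.

Definition uval f x : F := f (vsproj (ualg F n) x).

Lemma udual_eq f f' : (forall x, x \in ualg F n -> uval f x = uval f' x) -> f = f'.
Proof.
by move=> H; apply/lfunP => v; have := H _ (subvsP v); rewrite /uval vsvalK.
Qed.

Lemma uval_coad g f x : x \in ualg F n ->
  uval (coad g f) x = uval f (invmx g *m x *m g).
Proof. by move=> xu; rewrite /uval coadE vsprojK. Qed.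

Lemma uvalB f x y : uval f (x - y) = uval f x - uval f y.
Proof. by rewrite /uval !linearB. Qed.
Lemma uvalD f x y : uval f (x + y) = uval f x + uval f y.
Proof. by rewrite /uval !linearD. Qed.
Lemma uvalZ f c x : uval f (c *: x) = c * uval f x.
Proof. by rewrite /uval !linearZ. Qed.

Lemma uval_sum f I (r : seq I) (P : pred I) (E : I -> 'M[F]_(n + n)) :
  uval f (\sum_(i <- r | P i) E i) = \sum_(i <- r | P i) uval f (E i).
Proof. by rewrite /uval !linear_sum. Qed.

End Group.

(** * Stabilisers and orbit sizes *)
Section Radical.
Variables (F : finFieldType) (n : nat) (f : udual F n).
Implicit Types (x y z : 'M[F]_(n + n)).

(** The values of [f [_, x]] on a basis, gathered in a row so that the radical
    becomes the kernel of a linear map. *)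
Definition commval x : 'rV[F]_#|{: posroot n}| :=
  \row_b uval f ((rootbasis F n)`_b *m x - x *m (rootbasis F n)`_b).

Lemma commval_is_linear : linear commval.
Proof.
move=> c x y; apply/rowP => b; rewrite !mxE -uvalZ -uvalD; congr (uval f _).
rewrite mulmxDr mulmxDl opprD scalerBr -!scalemxAr -!scalemxAl.
by rewrite addrACA.
Qed.

HB.instance Definition _ :=
  GRing.isLinear.Build F 'M[F]_(n + n) 'rV[F]_#|{: posroot n}| _ commval commval_is_linear.

Definition radical : {vspace 'M[F]_(n + n)} := (ualg F n :&: lker (linfun commval))%VS.

Lemma radicalP x :
  reflect (x \in ualg F n /\ forall z, z \in ualg F n -> uval f (z *m x - x *m z) = 0)
          (x \in radical).
Proof.
rewrite memv_cap memv_ker lfunE /=; apply: (iffP andP) => -[xu H]; split=> //.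
  move=> z /coord_span ->; rewrite mulmx_suml mulmx_sumr -sumrB.
  rewrite uval_sum big1 // => b _.
  move/eqP/rowP/(_ b): H; rewrite !mxE -scalemxAl -scalemxAr -scalerBr => H.
  by rewrite uvalZ H mulr0.
apply/eqP/rowP => b; rewrite !mxE H // nth_codom; exact: mem_rootelt.
Qed.

End Radical.

Section Orbit.
Variables (F : finFieldType) (n p : nat).
Hypothesis two_neq0 : 2%:R != 0 :> F.
Implicit Types (x y z g h : 'M[F]_(n + n)) (f : udual F n).

Local Notation G := (sp_unip F n).

(** With [x] the Cayley transform of [g], substitute [y = (1 + x) z (1 - x)] in
    [f (g^-1 y g) = f y]: since [g = (1 - x)^-1 (1 + x)], the two arguments
    become [(1 - x) z (1 + x)] and [(1 + x) z (1 - x)], whose difference is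
    twice the commutator of [z] and [x]. *)
Lemma coad_fix f g : g \in G -> (coad g f == f) = (cayley g \in radical f).
Proof.
move=> Gg; have [ug sg] := sp_unipP _ Gg.
have xu := cayley_ualg two_neq0 Gg; have [lx sx] := ualgP _ xu.
have gE1 := cayley_mull two_neq0 ug; have gE2 := cayley_mulr two_neq0 ug.
set x := cayley g in xu lx sx gE1 gE2 *.
have ug1 := unip_unit ug.
have conjE z : invmx g *m ((1%:M + x) *m z *m (1%:M - x)) *m g
             = (1%:M - x) *m z *m (1%:M + x).
  by rewrite -{1}gE2 -!mulmxA gE1 mulKmx.
have commE z : (1%:M - x) *m z *m (1%:M + x) - (1%:M + x) *m z *m (1%:M - x)
             = 2%:R *: (z *m x - x *m z).
  rewrite !(mulmxDr, mulmxBr) !(mulmxDl, mulmxBl) !mulmx1 !mul1mx.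
  rewrite !(mulNmx, mulmxN) ?mulNmx.
  by apply/matrixP => a b; rewrite !mxE; ring.
have u1 : 1%:M + x \in unitmx by apply: unip_unit; exact: unipD1.
have u2 : 1%:M - x \in unitmx by apply: unip_unit; exact: unipB1.
have sp1 : spinv (1%:M + x) = 1%:M - x by rewrite spinvD spinv1 sx.
have sp2 : spinv (1%:M - x) = 1%:M + x by rewrite spinvD spinvN spinv1 sx opprK.
have spV A : A \in unitmx -> spinv (invmx A) *m spinv A = 1%:M.
  by move=> uA; rewrite -spinvM mulmxV // spinv1.
apply/eqP/idP => [E|/radicalP[_ H]]; last first.
  apply: udual_eq => y yu; rewrite uval_coad //.
  pose z := invmx (1%:M + x) *m y *m invmx (1%:M - x).
  have yE : y = (1%:M + x) *m z *m (1%:M - x).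
    by rewrite /z -!mulmxA mulVmx // mulmx1 mulKVmx.
  have [ly sy] := ualgP _ yu.
  have spV1 : spinv (invmx (1%:M + x)) = invmx (1%:M - x).
    by apply: (can_inj (mulmxK u2)); rewrite mulVmx // -sp1 spV.
  have spV2 : spinv (invmx (1%:M - x)) = invmx (1%:M + x).
    by apply: (can_inj (mulmxK u1)); rewrite mulVmx // -sp2 spV.
  have zu : z \in ualg F n.
    apply/ualgP; split.
      by rewrite /z; exact: low_conj (unipV (unipD1 lx)) (unipV (unipB1 lx)) ly.
    by rewrite /z !spinvM spV1 spV2 sy mulNmx mulmxN mulmxA.
  apply/eqP; rewrite -subr_eq0 -uvalB {2}yE yE conjE commE uvalZ H ?mulr0 //.
apply/radicalP; split=> // z zu; have [lz sz] := ualgP _ zu.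
pose y := (1%:M + x) *m z *m (1%:M - x).
have yu : y \in ualg F n.
  apply/ualgP; split; first by rewrite /y; exact: low_conj (unipD1 lx) (unipB1 lx) lz.
  by rewrite /y !spinvM sp1 sp2 sz mulNmx mulmxN mulmxA.
have := congr1 (fun f' => uval f' y) E; rewrite /= uval_coad // conjE => /eqP.
by rewrite -subr_eq0 -uvalB commE uvalZ mulf_eq0 (negPf two_neq0) => /eqP.
Qed.

Lemma coadM f g h : g \in G -> h \in G -> coad (g *m h) f = coad g (coad h f).
Proof.
move=> Gg Gh; have Ggh := sp_unipM Gg Gh; apply: udual_eq => x xu.
rewrite !uval_coad //; last exact: sp_unip_conj.
have [[ug sg] [uh sh]] := (sp_unipP _ Gg, sp_unipP _ Gh).
rewrite (sp_unip_invmx Ggh) (sp_unip_invmx Gg) (sp_unip_invmx Gh) spinvM.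
by rewrite !mulmxA.
Qed.

Lemma coad1 f : coad 1%:M f = f.
Proof. by apply: udual_eq => x xu; rewrite uval_coad // invmx1 mul1mx mulmx1. Qed.

Hypotheses (n_gt0 : (0 < n)%N) (charp : p \in [pchar F]) (np : (2 * n <= p)%N).

Lemma orbit_stabilizer f : #|G| = (#|coad_orbit f| * #|[set g in G | coad g f == f]|)%N.
Proof.
rewrite -sum1_card (partition_big_imset (fun g => coad g f)) /=.
rewrite /coad_orbit (UgrpE n_gt0 charp np two_neq0) -sum_nat_const.
apply: eq_bigr => _ /imsetP[h Gh ->]; have [uh _] := sp_unipP _ Gh.
have hu := unip_unit uh.
rewrite sum1dep_card -[RHS](card_imset _ (can_inj (mulKmx hu))).
apply: eq_card => g; apply/idP/imsetP => [|[k]].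
  rewrite inE => /andP[Gg /eqP E].
  exists (invmx h *m g); last by rewrite mulKVmx.
  have Gh' := sp_unipV Gh.
  by rewrite inE sp_unipM //= coadM // E -coadM // mulVmx // coad1.
move=> /setIdP[Gk /eqP E] ->.
by rewrite inE sp_unipM //= coadM // E.
Qed.

(** The Cayley transform identifies the stabiliser with a vector space, so its
    cardinal, and with it the cardinal of the orbit, is a power of [q]. *)
Lemma coad_orbit_card f : exists d, has_dim (coad_orbit f) d.
Proof.
exists (\dim (ualg F n) - \dim (radical f))%N; rewrite /has_dim.
have q0 : (0 < #|F|)%N by apply/card_gt0P; exists 0.
have stabE : #|[set g in G | coad g f == f]| = (#|F| ^ \dim (radical f))%N.
  rewrite -card_vspace -(card_in_imset (f := @cayley F (n + n))).
    apply: eq_card => x; apply/imsetP/idP => [[g]|xr].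
      by rewrite inE => /andP[Gg]; rewrite coad_fix // => ? ->.
    have : x \in [set x in ualg F n] by rewrite inE; case/radicalP: xr.
    rewrite -(cayley_im n_gt0 charp np two_neq0) => /imsetP[g Gg xE].
    by exists g => //; rewrite inE Gg coad_fix // -xE.
  move=> g h /setIdP[Gg _] /setIdP[Gh _].
  exact: (cayley_sp_unip_inj two_neq0).
have := orbit_stabilizer f.
rewrite stabE (card_sp_unip n_gt0 charp np two_neq0) card_vspace expnB //; last first.
  by apply: dimvS; exact: capvSl.
by move=> ->; rewrite mulnK // expn_gt0 q0.
Qed.

End Orbit.

(** * Block coordinates *)
Section Blocks.
Variables (F : finFieldType) (n : nat).
Implicit Types (x y z g h : 'M[F]_(n + n)) (a s k P Q R S : 'M[F]_n).

(** The lower block rows are listed in decreasing order of [i] in [neg i];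
    reversing them makes [pos i] and [neg i] the [i]-th indices of the two
    halves, in which coordinates the group is that of the standard symplectic
    form. *)
Definition flip_ix (i : 'I_(n + n)) : 'I_(n + n) :=
  match split i with
  | inl i => lshift n i
  | inr i => rshift n (rev_ord i)
  end.

Lemma flip_pos (i : 'I_n) : flip_ix (lshift n i) = pos i.
Proof.
rewrite /flip_ix; case: split_ordP => j /eqP.
  by rewrite ?eq_lrshift // eq_lshift => /eqP ->.
by rewrite ?eq_lrshift // eq_lshift => /eqP ->.
Qed.

Lemma flip_neg (i : 'I_n) : flip_ix (rshift n i) = neg i.
Proof.
rewrite /flip_ix; case: split_ordP => j /eqP.
  by rewrite ?eq_rlshift // eq_rshift => /eqP ->.
by rewrite ?eq_rlshift // eq_rshift => /eqP ->.
Qed.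

Lemma flip_ixK : involutive flip_ix.
Proof.
move=> i; case: (split_ordP i) => j ->; last first.
  by rewrite flip_neg [flip_ix _]flip_neg /neg rev_ordK.
by rewrite flip_pos [flip_ix _]flip_pos.
Qed.

Definition flip x : 'M[F]_(n + n) := \matrix_(i, j) x (flip_ix i) (flip_ix j).

Lemma flipK : involutive flip.
Proof. by move=> x; apply/matrixP => i j; rewrite !mxE !flip_ixK. Qed.

Lemma flipM x y : flip (x *m y) = flip x *m flip y.
Proof.
apply/matrixP => i j; rewrite !mxE (reindex_inj (inv_inj flip_ixK)).
by apply: eq_bigr => c _; rewrite !mxE.
Qed.

Lemma flip1 : flip 1%:M = 1%:M.
Proof. by apply/matrixP => i j; rewrite !mxE (inj_eq (inv_inj flip_ixK)). Qed.

Lemma flipB x y : flip (x - y) = flip x - flip y.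
Proof. by apply/matrixP => i j; rewrite !mxE. Qed.

Definition bmx P Q R S : 'M[F]_(n + n) := flip (block_mx P Q R S).

Lemma bmxP x : exists P Q R S, x = bmx P Q R S.
Proof.
exists (ulsubmx (flip x)), (ursubmx (flip x)), (dlsubmx (flip x)), (drsubmx (flip x)).
by rewrite /bmx submxK flipK.
Qed.

Lemma bmx_inj P Q R S P' Q' R' S' :
  bmx P Q R S = bmx P' Q' R' S' -> [/\ P = P', Q = Q', R = R' & S = S'].
Proof. by move/(inv_inj flipK)/eq_block_mx. Qed.

Lemma bmxM P Q R S P' Q' R' S' :
  bmx P Q R S *m bmx P' Q' R' S' =
  bmx (P *m P' + Q *m R') (P *m Q' + Q *m S') (R *m P' + S *m R') (R *m Q' + S *m S').
Proof. by rewrite /bmx -flipM mulmx_block. Qed.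

Lemma bmx1 : bmx 1%:M 0 0 1%:M = 1%:M.
Proof. by rewrite /bmx -scalar_mx_block flip1. Qed.

Lemma bmxB1 P Q R S : bmx P Q R S - 1%:M = bmx (P - 1%:M) Q R (S - 1%:M).
Proof.
rewrite -{1}bmx1 /bmx -flipB; congr flip.
by rewrite opp_block_mx add_block_mx !subr0.
Qed.

Lemma bmxN P Q R S : - bmx P Q R S = bmx (- P) (- Q) (- R) (- S).
Proof. by rewrite /bmx -opp_block_mx; apply/matrixP => i j; rewrite !mxE. Qed.

Lemma bmx_pp P Q R S i j : bmx P Q R S (pos i) (pos j) = P i j.
Proof. by rewrite /bmx -!flip_pos mxE !flip_ixK block_mxEul. Qed.
Lemma bmx_pn P Q R S i j : bmx P Q R S (pos i) (neg j) = Q i j.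
Proof. by rewrite /bmx -!flip_pos -flip_neg mxE !flip_ixK block_mxEur. Qed.
Lemma bmx_np P Q R S i j : bmx P Q R S (neg i) (pos j) = R i j.
Proof. by rewrite /bmx -!flip_pos -flip_neg mxE !flip_ixK block_mxEdl. Qed.
Lemma bmx_nn P Q R S i j : bmx P Q R S (neg i) (neg j) = S i j.
Proof. by rewrite /bmx -!flip_neg mxE !flip_ixK block_mxEdr. Qed.

Definition bmxE := (bmx_pp, bmx_pn, bmx_np, bmx_nn).

Lemma spinv_bmx P Q R S : spinv (bmx P Q R S) = bmx S^T (- Q^T) (- R^T) P^T.
Proof.
apply/matrixP => c d; case: (indexP c) => i; case: (indexP d) => j;
  by rewrite mxE ?(rev_pos, rev_neg, isgn_pos, isgn_neg) !bmxE !mxE; ring.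
Qed.

Lemma low1_bmx P Q R S : low 1 (bmx P Q R S) <-> [/\ low 1 P, Q = 0 & low 1 S^T].
Proof.
split=> [/lowP H|[/lowP lP -> /lowP lS]].
  split; first by apply/lowP => i j ij; rewrite -(bmx_pp P Q R S) H.
    apply/matrixP => i j; rewrite -(bmx_pn P Q R S) H ?mxE //=.
    by have := ltn_ord i; lia.
  apply/lowP => i j ij; rewrite mxE -(bmx_nn P Q R S) H //=.
  by have := ltn_ord i; have := ltn_ord j; lia.
apply/lowP => c d; case: (indexP c) => i; case: (indexP d) => j /=; rewrite bmxE => cd.
- exact: lP.
- by rewrite mxE.
- by have := ltn_ord j; lia.
- have := lS j i; rewrite mxE; apply.
  by have := ltn_ord i; have := ltn_ord j; lia.
Qed.

Definition umx a s := bmx a 0 s (- a^T).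

Lemma umxP x : reflect (exists a s, [/\ low 1 a, symm s & x = umx a s]) (x \in ualg F n).
Proof.
apply: (iffP (ualgP _)) => [[]|[a [s [la /eqP ss ->]]]]; last first.
  split; last by rewrite /umx spinv_bmx bmxN !linearN /= trmxK opprK ss trmx0.
  by apply/low1_bmx; split=> //; rewrite linearN /= trmxK lowN.
have [P [Q [R [S ->]]]] := bmxP x.
move/low1_bmx=> [lP -> lS]; rewrite spinv_bmx bmxN => /bmx_inj[sP _ /oppr_inj sR _].
exists P, R; split; rewrite /symm ?sR //.
by rewrite /umx -[P]opprK -sP linearN /= trmxK opprK.
Qed.

(** The factorisation [U = S N], with [N] the block diagonal matrices
    [diag (k, k^-T)] and [S] the normal abelian subgroup of the
    [1 + (0, s)]. *)
Definition gmx k s := bmx k 0 (s *m k) (invmx k)^T.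

Lemma gmxP g : reflect (exists k s, [/\ unip k, symm s & g = gmx k s]) (g \in sp_unip F n).
Proof.
have symE k s : symm s -> k^T *m (s *m k) = (s *m k)^T *m k.
  by move=> /eqP ss; rewrite trmx_mul ss mulmxA.
apply: (iffP (sp_unipP _)) => [[]|[k [s [uk ss ->]]]]; last first.
  split; rewrite /gmx.
    rewrite /unip bmxB1; apply/low1_bmx; split=> //.
    by rewrite linearB /= trmxK trmx1; exact: unipV.
  rewrite spinv_bmx bmxM trmx0 oppr0 !mul0mx !mulmx0 !addr0 trmxK.
  rewrite mulVmx ?unip_unit // add0r mulNmx symE // addNr.
  by rewrite -trmx_mul mulVmx ?unip_unit // trmx1 bmx1.
have [k [Q [R [S ->]]]] := bmxP g.
rewrite /unip bmxB1 => /low1_bmx[uk -> _]; rewrite spinv_bmx bmxM.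
rewrite trmx0 oppr0 !mul0mx !mulmx0 !addr0 add0r -bmx1 => /bmx_inj[E _ sR _].
have Sk : S^T = invmx k by rewrite -[LHS]mulmx1 -(mulmxV (unip_unit uk)) mulmxA E mul1mx.
exists k, (R *m invmx k); split=> //; last first.
  by rewrite /gmx mulmxKV ?unip_unit // -Sk trmxK.
move/eqP: sR; rewrite mulNmx addrC subr_eq0 => /eqP sR.
apply/eqP; rewrite trmx_mul -[R^T](mulmxK (unip_unit uk)) -sR !mulmxA -trmx_mul.
by rewrite mulmxV ?unip_unit // trmx1 mul1mx.
Qed.

Lemma umx_conj k s a b : unip k -> symm s ->
  invmx (gmx k s) *m umx a b *m gmx k s =
  umx (invmx k *m a *m k) (k^T *m (b - s *m a - a^T *m s) *m k).
Proof.
move=> uk ss; rewrite sp_unip_invmx; last by apply/gmxP; exists k, s.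
move/eqP: ss => ss.
rewrite /gmx /umx spinv_bmx !bmxM trmx0 oppr0 trmxK !(mul0mx, mulmx0) !(addr0, add0r).
congr bmx; rewrite ?(mul0mx, mulmx0) ?(addr0, add0r) //.
  rewrite trmx_mul ss mulNmx mulmxN.
  rewrite [X in X *m k]addrC mulmxBl !mulmxBr !mulmxBl !mulmxA.
  by rewrite !mulNmx.
by rewrite mulmxN mulNmx !trmx_mul !mulmxA.
Qed.

End Blocks.

(** * Symmetric forms under unitriangular congruence *)
Section Upper.
Variables (F : fieldType) (n : nat).
Implicit Types (a k L X Y B s : 'M[F]_n).

(** Linear forms on strictly lower triangular matrices are traces against [X]
    modulo lower triangular matrices; [supper X] is the representative that
    vanishes on and below the diagonal. *)
Definition supper X : 'M[F]_n := \matrix_(i, j) if (i < j)%N then X i j else 0.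

Lemma supper_eq X Y : low 0 (X - Y) -> supper X = supper Y.
Proof.
move=> /lowP H; apply/matrixP => i j; rewrite !mxE; case: ifP => // ij.
by apply/eqP; rewrite -subr_eq0; have := H i j; rewrite !mxE addn0 => ->.
Qed.

Lemma supper0 : supper 0 = 0.
Proof. by apply/matrixP => i j; rewrite !mxE if_same. Qed.

Lemma mxtrace_supper X a : low 1 a -> \tr (supper X *m a) = \tr (X *m a).
Proof.
move=> /lowP la; rewrite /mxtrace; apply: eq_bigr => i _; rewrite !mxE.
apply: eq_bigr => j _; rewrite mxE; case: ltnP => // ji.
by rewrite la ?mulr0 //; lia.
Qed.

Lemma mxtrace_delta X i j : \tr (X *m delta_mx i j) = X j i.
Proof.
rewrite /mxtrace (bigD1 j) //= big1 => [|l lj].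
  rewrite addr0 mxE (bigD1 i) //= big1 => [|l li]; first by rewrite mxE !eqxx addr0 mulr1.
  by rewrite mxE (negPf li) mulr0.
by rewrite mxE big1 // => l' _; rewrite mxE (negPf lj) andbF mulr0.
Qed.

Lemma delta_low (i j : 'I_n) : (j < i)%N -> low 1 (delta_mx i j : 'M[F]_n).
Proof.
move=> ji; apply/lowP => c d cd; rewrite mxE.
by case: andP => // -[/eqP ? /eqP ?]; subst; lia.
Qed.

Lemma supper_tr X Y :
  (forall a, low 1 a -> \tr (X *m a) = \tr (Y *m a)) -> supper X = supper Y.
Proof.
move=> H; apply/matrixP => i j; rewrite !mxE; case: ifP => // ij.
by rewrite -!mxtrace_delta H ?delta_low.
Qed.

Lemma symm_delta (i j : 'I_n) : symm (delta_mx i j + delta_mx j i : 'M[F]_n).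
Proof. by rewrite /symm linearD /= !trmx_delta addrC. Qed.

Lemma symm0 : symm (0 : 'M[F]_n).
Proof. by rewrite /symm trmx0. Qed.

Lemma symm_conj k s : symm s -> symm (k *m s *m k^T).
Proof. by move=> /eqP ss; rewrite /symm !trmx_mul trmxK ss mulmxA. Qed.

Hypothesis two_neq0 : 2%:R != 0 :> F.

(** The trace form is nondegenerate on symmetric matrices outside
    characteristic 2. *)
Lemma symm_tr X Y : symm X -> symm Y ->
  (forall s, symm s -> \tr (X *m s) = \tr (Y *m s)) -> X = Y.
Proof.
move=> /eqP sX /eqP sY H; apply/matrixP => i j.
have := H _ (symm_delta i j); rewrite !mulmxDr !linearD /= !mxtrace_delta.
rewrite -{1}sX -{1}sY !mxE => E.
by apply: (mulIf two_neq0); rewrite !mulr_natr !mulr2n.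
Qed.

(** Freeness of the congruence action at [B] is stated for the Lie algebra, where
    it is a linear condition; the Cayley transform shows that it means the same
    for the group ([free_act_inj], [inj_free_act]). *)
Definition free_act B := forall a, low 1 a -> a *m B + B *m a^T = 0 -> a = 0.

(** For [k] with Cayley transform [a], i.e. [(1 - a) k = 1 + a], this compares
    [k B k^T = B] with the infinitesimal equation [a B + B a^T = 0]. *)
Lemma cayley_stab a B :
  (1%:M + a) *m B *m (1%:M + a)^T - (1%:M - a) *m B *m (1%:M - a)^T
  = 2%:R *: (a *m B + B *m a^T).
Proof.
rewrite linearD linearB /= trmx1 !(mulmxDr, mulmxBr) !(mulmxDl, mulmxBl) !mulmx1 !mul1mx.
rewrite !mulNmx !(mulmxN, mulNmx) ?mulmx1.
by apply/matrixP => i j; rewrite !mxE; ring.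
Qed.

Lemma free_act_stab B k : free_act B -> unip k -> k *m B *m k^T = B -> k = 1%:M.
Proof.
move=> fB uk E; have la := cayley_low two_neq0 uk.
have /(fB _ la) a0 : cayley k *m B + B *m (cayley k)^T = 0.
  apply/eqP; have := cayley_stab (cayley k) B.
  rewrite -(cayley_mull two_neq0 uk) trmx_mul !mulmxA.
  rewrite -(mulmxA (1%:M - _)) -(mulmxA (1%:M - _)) E subrr => /esym/eqP.
  by rewrite scaler_eq0 (negPf two_neq0).
by have := cayley_mull two_neq0 uk; rewrite a0 subr0 addr0 mul1mx.
Qed.

Lemma free_act_inj B k k' : free_act B -> unip k -> unip k' ->
  k *m B *m k^T = k' *m B *m k'^T -> k = k'.
Proof.
move=> fB uk uk' E; have Uk' := unip_unit uk'.
suff : invmx k' *m k = 1%:M by move/(congr1 (mulmx k')); rewrite mulKVmx // mulmx1.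
apply: (free_act_stab fB); first by apply: unipM => //; exact: unipV.
have -> : invmx k' *m k *m B *m (invmx k' *m k)^T
        = invmx k' *m (k *m B *m k^T) *m (invmx k')^T by rewrite trmx_mul !mulmxA.
rewrite E !mulmxA mulVmx // mul1mx -mulmxA -trmx_mul mulVmx //.
by rewrite trmx1 mulmx1.
Qed.

Lemma inj_free_act B :
  (forall k k', unip k -> unip k' -> k *m B *m k^T = k' *m B *m k'^T -> k = k') ->
  free_act B.
Proof.
move=> inj a la E; have := cayley_stab a B; rewrite E scaler0 => /subr0_eq /inj.
move=> /(_ (unipD1 la) (unipB1 la)) => /addrI /eqP.
rewrite -subr_eq0 opprK -mulr2n -scaler_nat scaler_eq0 (negPf two_neq0).
by move/eqP.
Qed.

Lemma free_act_conj B k : unip k -> free_act B -> free_act (k *m B *m k^T).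
Proof.
move=> uk fB; apply: inj_free_act => h h' uh uh'.
have E x : x *m (k *m B *m k^T) *m x^T = (x *m k) *m B *m (x *m k)^T.
  by rewrite trmx_mul !mulmxA.
rewrite !E => /(free_act_inj fB (unipM uh uk) (unipM uh' uk)).
by apply: (can_inj (mulmxK (unip_unit uk))).
Qed.

(** The symmetric block [s] translates the part of [f] dual to the strictly lower
    triangular block by a multiple of [B s]; the condition says that these
    translations are transitive. *)
Definition low_solvable B :=
  forall L, exists2 s, symm s & low 0 (B *m s - L).

(** The maps [a |-> a B + B a^T] and [s |-> B s] are dual for the trace form. *)
Lemma low_solvable_free B : symm B -> low_solvable B -> free_act B.
Proof.
move=> /eqP sB solB a la E; apply/matrixP => j i; rewrite [RHS]mxE.
case: (ltnP j (i + 1)) => [ji|ij]; first by move/lowP: la => ->.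
have [s /eqP ss /supper_eq Es] := solB (delta_mx i j).
have tr0 : \tr (B *m s *m a) = 0.
  have := congr1 (fun X => \tr (s *m X)) E.
  rewrite mulmx0 mxtrace0 mulmxDr linearD /=.
  have -> : \tr (s *m (B *m a^T)) = \tr (s *m (a *m B)).
    by rewrite -mxtrace_tr !trmx_mul trmxK sB ss mxtrace_mulC.
  rewrite -mulr2n -mulr_natl => /eqP; rewrite mulf_eq0 (negPf two_neq0) /= => /eqP.
  by rewrite mulmxA mxtrace_mulC mulmxA.
move: tr0; rewrite -(mxtrace_supper _ la) Es mxtrace_supper //.
by rewrite mxtrace_mulC mxtrace_delta.
Qed.

End Upper.

Section Counting.
Variables (F : finFieldType) (n : nat).
Implicit Types (k B : 'M[F]_n).

Definition unips : {set 'M[F]_n} := [set k | unip k].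
Definition suppers : {set 'M[F]_n} := [set L | supper L == L].
Definition congr_orbit B : {set 'M[F]_n} := [set k *m B *m k^T | k in unips].

Hypothesis two_neq0 : 2%:R != 0 :> F.

Lemma card_congr_orbit B : (#|congr_orbit B| <= #|unips|)%N.
Proof. exact: leq_imset_card. Qed.

Lemma free_act_card B : free_act B <-> #|congr_orbit B| = #|unips|.
Proof.
split=> [fB|/eqP/imset_injP inj].
  by apply: card_in_imset => k k'; rewrite !inE; exact: free_act_inj.
apply: inj_free_act => // k k' uk uk'; apply: inj; rewrite inE //.
Qed.

End Counting.

(** * The coadjoint action in block coordinates *)
Section Parts.
Variables (F : finFieldType) (n p : nat).
Hypothesis two_neq0 : 2%:R != 0 :> F.
Implicit Types (a s k L B X Y : 'M[F]_n) (f : udual F n).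

Definition upart f : 'M[F]_n :=
  \matrix_(i, j) if (i < j)%N then uval f (umx (delta_mx j i) 0) else 0.

(** An entry of a symmetric matrix off the diagonal is counted twice by the
    trace, and [delta_mx i j + delta_mx j i] is twice a matrix unit when
    [i = j]; the factor [2^-1] corrects both at once. *)
Definition spart f : 'M[F]_n :=
  \matrix_(i, j) (2%:R^-1 * uval f (umx 0 (delta_mx i j + delta_mx j i))).

Lemma umxD a s a' s' : umx (a + a') (s + s') = umx a s + umx a' s'.
Proof.
rewrite /umx /bmx linearD opprD /= -{1}[0]addr0 -add_block_mx.
by apply/matrixP => i j; rewrite !mxE.
Qed.

Lemma umxZ c a s : umx (c *: a) (c *: s) = c *: umx a s.
Proof.
rewrite /umx /bmx linearZ /= -scalerN -{1}[0](scaler0 _ c) -scale_block_mx.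
by apply/matrixP => i j; rewrite !mxE.
Qed.

Lemma umx_split a s : umx a s = umx a 0 + umx 0 s.
Proof. by rewrite -umxD addr0 add0r. Qed.

Lemma umx0Z c s : umx 0 (c *: s) = c *: umx 0 s.
Proof. by rewrite -umxZ scaler0. Qed.

Lemma umxZ0 c a : umx (c *: a) 0 = c *: umx a 0.
Proof. by rewrite -umxZ scaler0. Qed.

Lemma umx_mem a s : low 1 a -> symm s -> umx a s \in ualg F n.
Proof. by move=> la ss; apply/umxP; exists a, s. Qed.

Lemma low0mx : low 1 (0 : 'M[F]_n).
Proof. by apply/lowP => i j _; rewrite mxE. Qed.

Lemma umx_0 : umx 0 0 = 0 :> 'M[F]_(n + n).
Proof. by rewrite -[X in umx X _](scale0r 0) umxZ0 scale0r. Qed.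

Lemma umx_suml I (r : seq I) (P : pred I) (E : I -> 'M[F]_n) :
  umx (\sum_(i <- r | P i) E i) 0 = \sum_(i <- r | P i) umx (E i) 0.
Proof.
apply: (big_morph (fun a => umx a 0)); last exact: umx_0.
by move=> a b; rewrite -umxD addr0.
Qed.

Lemma umx_sumr I (r : seq I) (P : pred I) (E : I -> 'M[F]_n) :
  umx 0 (\sum_(i <- r | P i) E i) = \sum_(i <- r | P i) umx 0 (E i).
Proof.
apply: (big_morph (fun s => umx 0 s)); last exact: umx_0.
by move=> a b; rewrite -umxD addr0.
Qed.

Lemma symm_decomp s : symm s ->
  s = 2%:R^-1 *: \sum_i \sum_j s i j *: (delta_mx i j + delta_mx j i).
Proof.
move=> /eqP ss.
have -> : \sum_i \sum_j s i j *: (delta_mx i j + delta_mx j i) = s + s^T.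
  rewrite [X in _ = X + _]matrix_sum_delta [X in _ = _ + X^T]matrix_sum_delta.
  rewrite linear_sum -big_split /=.
  apply: eq_bigr => i _; rewrite linear_sum -big_split /=; apply: eq_bigr => j _.
  by rewrite linearZ /= trmx_delta scalerDr.
by rewrite ss -mulr2n -scaler_nat scalerA mulVf // scale1r.
Qed.

Lemma uvalE f a s : low 1 a -> symm s ->
  uval f (umx a s) = \tr (upart f *m a) + \tr (spart f *m s).
Proof.
move=> la ss; rewrite umx_split uvalD; congr (_ + _).
  rewrite [a in LHS]matrix_sum_delta exchange_big umx_suml uval_sum /mxtrace.
  apply: eq_bigr => i _; rewrite umx_suml uval_sum mxE; apply: eq_bigr => j _.
  rewrite umxZ0 uvalZ mxE mulrC; case: ltnP => // ji.
  by move/lowP: la => ->; rewrite ?mulr0 //; lia.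
rewrite {1}(symm_decomp ss) umx0Z uvalZ umx_sumr uval_sum mulr_sumr.
rewrite /mxtrace; apply: eq_bigr => i _; rewrite umx_sumr uval_sum mulr_sumr mxE.
apply: eq_bigr => j _; rewrite umx0Z uvalZ mxE.
by rewrite -[in RHS](eqP ss) mxE mulrCA mulrC.
Qed.

Lemma spart_symm f : symm (spart f).
Proof. by apply/eqP/matrixP => i j; rewrite !mxE addrC. Qed.

Lemma supper_upart f : supper (upart f) = upart f.
Proof. by apply/matrixP => i j; rewrite !mxE; case: (i < j)%N. Qed.

Lemma spart_unique f B : symm B ->
  (forall s, symm s -> uval f (umx 0 s) = \tr (B *m s)) -> spart f = B.
Proof.
move=> sB H; apply: (symm_tr two_neq0) => // [|s ss]; first exact: spart_symm.
by rewrite -H // uvalE ?low0mx // mulmx0 mxtrace0 add0r.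
Qed.

Lemma upart_unique f L :
  (forall a, low 1 a -> uval f (umx a 0) = \tr (L *m a)) -> upart f = supper L.
Proof.
move=> H; rewrite -supper_upart; apply: supper_tr => a la.
by rewrite -H // uvalE ?symm0 // mulmx0 mxtrace0 addr0.
Qed.

Lemma parts_inj f f' : upart f = upart f' -> spart f = spart f' -> f = f'.
Proof.
move=> Eu Es; apply: udual_eq => _ /umxP[a [s [la ss ->]]].
by rewrite !uvalE // Eu Es.
Qed.

Lemma spart_coad f k s : unip k -> symm s ->
  spart (coad (gmx k s) f) = k *m spart f *m k^T.
Proof.
move=> uk ss; apply: spart_unique => [|t st].
  by apply: symm_conj; exact: spart_symm.
rewrite uval_coad ?umx_mem ?low0mx // umx_conj // trmx0 !(mulmx0, mul0mx) !subr0.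
have st' := symm_conj (k^T) st; rewrite trmxK in st'.
by rewrite uvalE ?low0mx // mulmx0 mxtrace0 add0r -!mulmxA [RHS]mxtrace_mulC !mulmxA.
Qed.

Lemma upart_coad f k s : unip k -> symm s ->
  upart (coad (gmx k s) f) =
  supper (k *m upart f *m invmx k - 2%:R *: (k *m spart f *m k^T *m s)).
Proof.
move=> uk ss; apply: upart_unique => a la.
rewrite uval_coad ?umx_mem ?symm0 // umx_conj // sub0r.
have sas : symm (- (s *m a) - a^T *m s).
  by rewrite /symm linearB linearN /= !trmx_mul trmxK (eqP ss) addrC.
have := symm_conj (k^T) sas; rewrite trmxK => ss'.
rewrite uvalE //; last by apply: low_conj => //; exact: unipV.
rewrite [in RHS]mulmxBl [RHS]raddfB; congr (_ + _).
  by rewrite -!mulmxA [RHS]mxtrace_mulC !mulmxA.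
have -> : \tr (spart f *m (k^T *m (- (s *m a) - a^T *m s) *m k)) =
          \tr (k *m spart f *m k^T *m (- (s *m a) - a^T *m s)).
  by rewrite -!mulmxA [RHS]mxtrace_mulC !mulmxA.
have /eqP := symm_conj k (spart_symm f); move: (k *m spart f *m k^T) => B sB.
rewrite mulmxBr mulmxN linearB linearN /= -scalemxAl linearZ /=.
have -> : \tr (B *m (a^T *m s)) = \tr (B *m (s *m a)).
  by rewrite -mxtrace_tr !trmx_mul trmxK sB (eqP ss) mxtrace_mulC.
by rewrite !mulmxA; ring.
Qed.

Hypotheses (n_gt0 : (0 < n)%N) (charp : p \in [pchar F]) (np : (2 * n <= p)%N).

Lemma coad_orbitP f f' :
  reflect (exists k s, [/\ unip k, symm s & f' = coad (gmx k s) f]) (f' \in coad_orbit f).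
Proof.
rewrite /coad_orbit (UgrpE n_gt0 charp np two_neq0).
apply: (iffP imsetP) => [[g /gmxP[k [s [uk ss ->]]] ->]|[k [s [uk ss ->]]]].
  by exists k, s.
by exists (gmx k s) => //; apply/gmxP; exists k, s.
Qed.

Lemma parts_pair_inj : injective (fun f => (spart f, upart f)).
Proof. by move=> f f' [Es Eu]; exact: parts_inj. Qed.

(** In an orbit the symmetric parts form one congruence orbit, and for each of
    them there are at most as many forms as strictly upper triangular parts. *)
Lemma orbit_card_le f :
  (#|coad_orbit f| <= #|congr_orbit (spart f)| * #|suppers F n|)%N.
Proof.
rewrite -cardsX -(card_imset _ parts_pair_inj); apply/subset_leq_card/subsetP.
move=> _ /imsetP[_ /coad_orbitP[k [s [uk ss ->]]] ->].
rewrite !inE supper_upart eqxx andbT spart_coad //.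
by apply/imsetP; exists k => //; rewrite inE.
Qed.

(** Conjugation by [k] preserves lower triangular matrices, so it suffices to
    reach [k^-1 L k] by a translation before moving by [k]. *)
Lemma low_solvable_orbit f L k : low_solvable (spart f) -> unip k ->
  exists2 f', f' \in coad_orbit f & spart f' = k *m spart f *m k^T /\ upart f' = supper L.
Proof.
move=> solB uk; have Uk := unip_unit uk; have uVk := unipV uk.
pose L' := 2%:R^-1 *: (upart f - invmx k *m L *m k).
have [s ss /lowP H] := solB L'.
(* [gmx k t] translates after moving by [k], hence the change of variable *)
pose t := (invmx k)^T *m s *m invmx k.
have st : symm t by have := symm_conj (invmx k)^T ss; rewrite trmxK.
exists (coad (gmx k t) f); first by apply/coad_orbitP; exists k, t.
split; [exact: spart_coad | rewrite upart_coad //; apply: supper_eq].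
have -> : k *m upart f *m invmx k - 2%:R *: (k *m spart f *m k^T *m t) - L
        = k *m ((- 2%:R) *: (spart f *m s - L')) *m invmx k.
  rewrite /t /L' scalerBr scalerA mulNr mulfV // scaleN1r opprK.
  rewrite !mulmxDr !mulmxDl mulmxN mulNmx !mulmxA.
  rewrite -(mulmxA (k *m spart f) k^T) -trmx_mul mulVmx // trmx1 mulmx1.
  rewrite mulmxV // mul1mx mulmxK // -!scalemxAr -!scalemxAl !scaleNr !mulmxA.
  by rewrite addrA [X in _ = X - _]addrC.
apply: low_conj => //; apply: lowZ; exact/lowP.
Qed.

Lemma low_solvable_card f : low_solvable (spart f) ->
  #|coad_orbit f| = (#|unips F n| * #|suppers F n|)%N.
Proof.
move=> solB; have fB := low_solvable_free two_neq0 (spart_symm f) solB.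
have /(free_act_card two_neq0) cB := fB.
apply/eqP; rewrite eqn_leq -cB orbit_card_le andTb.
rewrite -cardsX -[X in (_ <= X)%N](card_imset _ parts_pair_inj).
apply/subset_leq_card/subsetP => -[B L]; rewrite inE /= => /andP[/imsetP[k]].
rewrite !inE => uk -> /eqP EL.
have [f' Of' [<- Eu]] := low_solvable_orbit L solB uk.
by apply/imsetP; exists f' => //; rewrite Eu EL.
Qed.

Lemma card_gt0_suppers : (0 < #|suppers F n|)%N.
Proof.
by apply/card_gt0P; exists 0; rewrite inE supper0.
Qed.

Lemma max_free f : (#|unips F n| * #|suppers F n| <= #|coad_orbit f|)%N ->
  free_act (spart f).
Proof.
move=> H; apply/(free_act_card two_neq0)/eqP; rewrite eqn_leq card_congr_orbit /=.
by rewrite -(leq_pmul2r card_gt0_suppers) (leq_trans H) // orbit_card_le.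
Qed.

End Parts.

(** * Normal forms of symmetric matrices *)
Section NormalForm.
Variables (F : fieldType) (n : nat).
Implicit Types (B h s : 'M[F]_n) (t : 'I_n -> 'I_n) (i j : 'I_n).

Definition tiling t := involutive t /\ forall i, (t i <= i.+1)%N.

Lemma tiling_ge t i : tiling t -> (i <= (t i).+1)%N.
Proof. by case=> tK tS; have := tS (t i); rewrite tK. Qed.

Definition supported B t := forall i j, B i j != 0 -> j = t i.

(** The condition at the last index is dropped because row [n] of [B s] has no
    entry strictly above the diagonal; this is where [xi] may vanish. *)
Definition nf B t :=
  [/\ tiling t, supported B t & forall i, (i.+1 < n)%N -> B i (t i) != 0].

Lemma supported0 B t i j : supported B t -> j != t i -> B i j = 0.
Proof. by move=> sup jt; apply/eqP; apply: contraNT jt => /sup ->. Qed.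

(** For [i < j] the equation at [(i, j)] reads [B i (t i) * s (t i) j = L i j];
    distinct pairs ask for distinct entries of the symmetric matrix [s] because
    [t] moves indices by at most one. *)
Lemma nf_low_solvable B t : nf B t -> low_solvable B.
Proof.
move=> [tilt sup nz] L; have [tK tS] := tilt.
pose s : 'M[F]_n := \matrix_(k, j) if (t k < j)%N then L (t k) j / B (t k) k
                      else if (t j < k)%N then L (t j) k / B (t j) j else 0.
exists s.
  apply/eqP/matrixP => j k; rewrite !mxE.
  case: ltnP => jk; case: ltnP => kj //.
  have -> // : j = k.
  apply: val_inj => /=; have := tiling_ge j tilt; have := tiling_ge k tilt.
  by have := tS j; have := tS k; lia.
apply/lowP => i j; rewrite addn0 => ij; rewrite !mxE (bigD1 (t i)) //= big1 => [|l lt].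
  rewrite mxE tK ij addr0 mulrC divfK ?subrr // nz //.
  by have := ltn_ord j; lia.
by rewrite (supported0 sup) ?mul0r.
Qed.

(** Uniqueness in the Bruhat decomposition: [h B = B' (h^T)^-1] with [h] lower
    and [(h^T)^-1] upper unitriangular. At [(i, j)] both sides reduce to the
    entry itself, unless there is a nonzero entry above or to the left; that
    entry is shared by [B] and [B'] by induction and forces zero at [(i, j)] in
    both. *)
Lemma congr_supported_eq B B' t t' h :
  symm B -> symm B' -> supported B t -> supported B' t' -> unip h ->
  h *m B *m h^T = B' -> B = B'.
Proof.
move=> /eqP sB /eqP sB' sup sup' uh E.
have symB i j : B i j = B j i by rewrite -{1}sB mxE.
have symB' i j : B' i j = B' j i by rewrite -{1}sB' mxE.
have uV := unipV uh; have Uh := unip_unit uh.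
have E' : h *m B = B' *m (invmx h)^T.
  by rewrite -E -mulmxA -trmx_mul mulVmx // trmx1 mulmx1.
suff H d i j : (i + j < d)%N -> B i j = B' i j.
  by apply/matrixP => i j; apply: (H (i + j).+1).
elim: d i j => // d IH i j ijd.
case: (pickP (fun l : 'I_n => (l < i)%N && (B l j != 0))) => [l /andP[li Bl]|nol].
  have Bl' : B' l j != 0 by rewrite -IH //; lia.
  have il : i != l by rewrite -val_eqE /= gtn_eqF.
  rewrite symB symB' (supported0 sup) ?(supported0 sup') //.
    by rewrite -(sup' j l) // -symB'.
  by rewrite -(sup j l) // -symB.
case: (pickP (fun l : 'I_n => (l < j)%N && (B i l != 0))) => [l /andP[lj Bl]|nol'].
  have Bl' : B' i l != 0 by rewrite -IH //; lia.
  have jl : j != l by rewrite -val_eqE /= gtn_eqF.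
  by rewrite (supported0 sup) ?(supported0 sup') -?(sup _ _ Bl) -?(sup' _ _ Bl').
have := congr1 (fun X : 'M_n => X i j) E'; rewrite /= !mxE (bigD1 i) //=.
rewrite [in RHS](bigD1 j) //= !big1 => [|l lj|l li].
- by rewrite unip_diag // !mxE unip_diag // mul1r mulr1 !addr0.
- case: (ltngtP l j) => jl; last by move/val_inj: jl lj => ->; rewrite eqxx.
    have := nol' l; rewrite jl /= => /negbFE/eqP Bl; rewrite -IH ?Bl ?mul0r //.
    by lia.
  rewrite mxE; have /lowP/(_ j l) := uV; rewrite !mxE => H.
  have {}H : invmx h j l = 0.
    have := H ltac:(lia); rewrite eq_sym (negPf lj) => /eqP.
    by rewrite subr0 => /eqP.
  by rewrite H mulr0.
- case: (ltngtP l i) => il; last by move/val_inj: il li => ->; rewrite eqxx.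
    by have := nol l; rewrite il /= => /negbFE/eqP ->; rewrite mulr0.
  have /lowP/(_ i l) := uh; rewrite !mxE => H.
  have {}H : h i l = 0.
    have := H ltac:(lia); rewrite eq_sym (negPf li) => /eqP.
    by rewrite subr0 => /eqP.
  by rewrite H mul0r.
Qed.

(** The congruence by [1 - u e_k^T], which subtracts [u i] times row [k] from row
    [i], and likewise for columns. *)
Definition shear B k (u : 'I_n -> F) : 'M[F]_n :=
  \matrix_(i, j) (B i j - u i * B k j - B i k * u j + u i * u j * B k k).

Lemma shear_congr B (k : 'I_n) u : (forall j, (j <= k)%N -> u j = 0) ->
  exists2 h, unip h & h *m B *m h^T = shear B k u.
Proof.
move=> u0; pose a : 'M[F]_n := \matrix_(i, j) (u i * (j == k)%:R).
have la : low 1 a.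
  apply/lowP => i j ij; rewrite mxE; case: eqP => [jk|_]; rewrite ?mulr0 //.
  by rewrite u0 ?mul0r //; move: ij; rewrite jk; lia.
exists (1%:M - a); first exact: unipB1.
have aM (C : 'M[F]_n) : a *m C = \matrix_(i, j) (u i * C k j).
  apply/matrixP => i j; rewrite !mxE (bigD1 k) //= big1 => [|l lk].
    by rewrite mxE eqxx mulr1 addr0.
  by rewrite mxE (negPf lk) mulr0 mul0r.
have Ma (C : 'M[F]_n) : C *m a^T = \matrix_(i, j) (C i k * u j).
  by rewrite -[LHS]trmxK trmx_mul trmxK aM; apply/matrixP => i j; rewrite !mxE mulrC.
rewrite [(_ - _)^T]raddfB /= trmx1 mulmxBr mulmx1 mulmxBl mul1mx Ma aM.
by apply/matrixP => i j; rewrite !mxE; ring.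
Qed.

Hypothesis two_neq0 : 2%:R != 0 :> F.

(** [B] splits as a normal form on the first [m] indices and an arbitrary
    symmetric matrix on the others. *)
Definition nf_upto m B t := forall i, (i < m)%N ->
  [/\ (t i < m)%N, t (t i) = i, (t i <= i.+1)%N, B i (t i) != 0
     & forall j, B i j != 0 -> j = t i].

Lemma nf_upto0 m B t i j : symm B -> nf_upto m B t -> (i < m <= j)%N ->
  B i j = 0 /\ B j i = 0.
Proof.
move=> /eqP sB nfB /andP[im mj]; have [tm _ _ _ H] := nfB i im.
have Bij : B i j = 0 by apply/eqP; apply: contraTT tm => /H <-; rewrite -leqNgt.
by split=> //; rewrite -sB mxE.
Qed.

Lemma nf_upto_end m B t : symm B -> nf_upto m B t -> (n <= m.+1)%N ->
  nf B (fun i => if (i < m)%N then t i else i).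
Proof.
move=> sB nfB nm; split.
- split=> i; case: (ltnP i m) => im //.
  + by have [-> -> _ _ _] := nfB i im.
  + by rewrite ltnNge im.
  + by have [] := nfB i im.
- move=> i j; case: ltnP => [/nfB[_ _ _ _]|mi Bij]; first exact.
  apply: val_inj; case: (ltnP j m) => jm.
    by have [_] := nf_upto0 sB nfB (introT andP (conj jm mi)); move/eqP: Bij.
  by have := ltn_ord i; have := ltn_ord j; rewrite /=; lia.
- move=> i im; have im' : (i < m)%N by lia.
  by rewrite im'; have [] := nfB i im'.
Qed.

Lemma shear_upto m B t (k : 'I_n) u : symm B -> nf_upto m B t -> (m <= k)%N ->
  (forall j, (j <= k)%N -> u j = 0) -> nf_upto m (shear B k u) t.
Proof.
move=> sB nfB mk u0 i im; have ik : (i < m <= k)%N by rewrite im.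
have [Bik _] := nf_upto0 sB nfB ik.
have E j : shear B k u i j = B i j.
  by rewrite mxE (u0 i) ?Bik; [ring | lia].
have [? ? ? ? H] := nfB i im; rewrite E; split=> // j; rewrite E; exact: H.
Qed.

Lemma shear_symm B (k : 'I_n) u : symm B -> symm (shear B k u).
Proof.
move=> /eqP sB; apply/eqP/matrixP => i j; rewrite !mxE.
have symB i' j' : B i' j' = B j' i' by rewrite -{1}sB mxE.
by rewrite (symB j i) (symB k i) (symB j k); ring.
Qed.

(** Subtracting multiples of row and column [k] from the later ones isolates a
    nonzero diagonal entry as a block of size one. *)
Lemma pivot_diag m B t (k : 'I_n) : symm B -> nf_upto m B t -> k = m :> nat ->
  B k k != 0 ->
  exists2 h, unip h & nf_upto m.+1 (h *m B *m h^T) (fun i => if (i < m)%N then t i else i).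
Proof.
move=> sB nfB km bk; pose u j := if (k < j)%N then B k j / B k k else 0.
have u0 j : (j <= k)%N -> u j = 0 by move=> jk; rewrite /u ltnNge jk.
have [h uh hE] := shear_congr B u0; exists h => //; rewrite hE => i im.
case: (ltnP i m) => im'.
  have [tm tK ts nz H] := shear_upto sB nfB (eq_leq (esym km)) u0 im'.
  by rewrite tm ltnW.
have {im im'} -> : i = k by apply: val_inj => /=; lia.
have E j : shear B k u k j = if j == k then B k k else 0.
  rewrite mxE (u0 k) //; case: eqP => [->|/eqP jk]; first by rewrite u0 //; ring.
  rewrite /u; case: ltnP => kj; first by field.
  have [|_ ->] := nf_upto0 (i := j) (j := k) sB nfB; last by ring.
  by rewrite -km leqnn andbT ltn_neqAle kj andbT.
rewrite -km ltnn ltnSn E eqxx; split=> // j; rewrite E.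
by case: (j =P k) => // _; rewrite eqxx.
Qed.

(** With a zero on the diagonal and [B k l] nonzero, row [k] is used to clear row
    [l], then row [l], now supported at [k], to clear row [k]. This leaves a
    block of size two. *)
Lemma pivot_pair m B t (k l : 'I_n) : symm B -> nf_upto m B t -> k = m :> nat ->
  l = m.+1 :> nat -> B k k = 0 -> B k l != 0 ->
  exists2 h, unip h & nf_upto m.+2 (h *m B *m h^T)
    (fun i => if (i < m)%N then t i else if i == k then l else k).
Proof.
move=> sB nfB km lm Bkk b0.
have mk : (m <= k)%N by rewrite km.
have ml : (m <= l)%N by rewrite lm.
have lk : (l == k) = false by apply/eqP => /(congr1 val) /=; lia.
(* [c] is [u l]: clearing the diagonal entry at [l] costs [2 c B k l], the row
   and the column operation contributing equally *)
pose c := B l l / (2%:R * B k l).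
pose u j := if (k < j)%N then (B l j - c * B k j) / B k l else 0.
have u0 j : (j <= k)%N -> u j = 0 by move=> jk; rewrite /u ltnNge jk.
pose B2 := shear B k u.
have sB2 : symm B2 by exact: shear_symm.
have nfB2 : nf_upto m B2 t by exact: shear_upto.
have symB i j : B i j = B j i by rewrite -{1}(eqP sB) mxE.
have low0 (i : 'I_n) : (i < k)%N -> B k i = 0 /\ B l i = 0.
  rewrite km => im.
  by split; [have [] := nf_upto0 (j := k) sB nfB (introT andP (conj im mk))
            |have [] := nf_upto0 (j := l) sB nfB (introT andP (conj im ml))].
have kl : (k < l)%N by rewrite lm km.
have ul : u l = c by rewrite /u kl /c; field; rewrite ?two_neq0 ?b0.
have B2k j : B2 k j = B k j by rewrite mxE (u0 k) // Bkk; ring.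
have B2l j : B2 l j = if j == k then B k l else 0.
  rewrite mxE ul Bkk (symB l k); case: eqP => [->|/eqP jk].
    by rewrite (u0 k) // Bkk (symB l k); ring.
  case: (ltnP k j) => kj; first by rewrite /u kj; field.
  have [|-> ->] := low0 j; first by rewrite ltn_neqAle jk.
  by rewrite u0 //; ring.
pose v j := if (l < j)%N then B k j / B k l else 0.
have v0 j : (j <= l)%N -> v j = 0 by move=> jl; rewrite /v ltnNge jl.
have vk : v k = 0 by apply: v0; rewrite ltnW.
have [h uh hE] := shear_congr B u0; have [h' uh' hE'] := shear_congr B2 v0.
exists (h' *m h); first exact: unipM.
have -> : h' *m h *m B *m (h' *m h)^T = shear B2 l v.
  by rewrite -hE' /B2 -hE trmx_mul !mulmxA.
have nf3 := shear_upto sB2 nfB2 ml v0.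
have Ek j : shear B2 l v k j = if j == l then B k l else 0.
  rewrite mxE vk B2k B2k; case: eqP => [->|/eqP jl]; first by rewrite v0 //; ring.
  rewrite /v; case: ltnP => lj; first by field.
  have [->|jk] := eqVneq j k; first by rewrite Bkk; ring.
  have [|-> _] := low0 j; last by ring.
  by move: jl jk; rewrite -!val_eqE /=; lia.
have El j : shear B2 l v l j = if j == k then B k l else 0.
  by rewrite mxE !B2l lk (v0 l) //; ring.
move=> i im; case: (ltnP i m) => im'.
  have [tm tK ts nz H] := nf3 _ im'.
  by rewrite tm; split=> //; lia.
have kmF : (k < m)%N = false by rewrite km ltnn.
have lmF : (l < m)%N = false by apply/negbTE; rewrite -leqNgt.
have [->|ik] := eqVneq i k.
  rewrite lmF lk Ek eqxx; split=> //; rewrite ?lm ?km // => j.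
  by rewrite Ek; case: (j =P l) => //; rewrite eqxx.
have -> : i = l by move: ik; rewrite -val_eqE /= => ik; apply: val_inj => /=; lia.
rewrite kmF eqxx El eqxx; split=> //; rewrite ?lm ?km //; first by lia.
by move=> j; rewrite El; case: (j =P k) => //; rewrite eqxx.
Qed.

(** If the pivot row [r] vanishes on the diagonal and just after it, then the
    antisymmetric matrix [r^T s - s^T r], with [s] the next row, is of the form
    [a B] with [a] strictly lower triangular. Freeness gives [a = 0], hence
    [r = 0]; but then the matrix unit at [(l, k)] annihilates [B]. *)
Lemma free_pivot m B t (k l : 'I_n) : symm B -> nf_upto m B t -> k = m :> nat ->
  l = m.+1 :> nat -> free_act B -> B k k = 0 -> B k l != 0.
Proof.
move=> sB nfB km lm fB Bkk; apply/eqP => Bkl.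
have mk : (m <= k)%N by rewrite km.
have ml : (m <= l)%N by rewrite lm.
have lk : (l == k) = false by apply/eqP => /(congr1 val) /=; lia.
have symB i j : B i j = B j i by rewrite -{1}(eqP sB) mxE.
have low0 (i : 'I_n) : (i < k)%N -> B k i = 0 /\ B l i = 0.
  rewrite km => im.
  by split; [have [] := nf_upto0 (j := k) sB nfB (introT andP (conj im mk))
            |have [] := nf_upto0 (j := l) sB nfB (introT andP (conj im ml))].
have rowk i : B k i = 0.
  pose a : 'M[F]_n := \matrix_(i, j) (B k i * (j == l)%:R - B l i * (j == k)%:R).
  have la : low 1 a.
    apply/lowP => i' j ij; rewrite mxE.
    case: eqP => [jl|_]; case: eqP => [jk|_]; rewrite ?mulr0 ?subrr //.
    - by move/eqP: lk; rewrite -jl -jk.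
    - rewrite subr0 mulr1.
      case: (ltngtP i' k) => [/low0[] //| ki |/val_inj -> //].
      by have -> : i' = l by apply: val_inj; move: ij; rewrite jl /=; lia.
    - rewrite sub0r mulr1; case: (ltngtP i' k) => [/low0[_ ->]| ki |/val_inj ->].
      + by rewrite oppr0.
      + by move: ij; rewrite jk; lia.
      + by rewrite symB Bkl oppr0.
  have aB i' j : (a *m B) i' j = B k i' * B l j - B l i' * B k j.
    rewrite mxE (bigD1 l) //= (bigD1 k) /=; last by rewrite eq_sym lk.
    rewrite big1 => [|c /andP[cl ck]]; last first.
      by rewrite mxE (negPf cl) (negPf ck) !mulr0 subrr mul0r.
    by rewrite !mxE !eqxx lk [k == l]eq_sym lk /=; ring.
  have a0 : a = 0.
    apply: fB => //; apply/matrixP => i' j.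
    have -> : B *m a^T = (a *m B)^T by rewrite trmx_mul (eqP sB).
    by rewrite mxE aB [_^T i' j]mxE aB mxE; ring.
  by have := congr1 (fun X : 'M_n => X i l) a0; rewrite /= !mxE eqxx lk mulr0 subr0 mulr1.
have aB : delta_mx l k *m B = 0.
  apply/matrixP => i j; rewrite mxE (bigD1 k) //= big1 => [|c ck].
    by rewrite rowk mulr0 addr0 mxE.
  by rewrite mxE (negPf ck) andbF mul0r.
have /fB : low 1 (delta_mx l k : 'M[F]_n) by apply: delta_low; rewrite lm km.
have -> : B *m (delta_mx l k)^T = (delta_mx l k *m B)^T by rewrite trmx_mul (eqP sB).
rewrite aB trmx0 addr0 => /(_ erefl) /matrixP /(_ l k); rewrite !mxE !eqxx => /eqP.
by rewrite oner_eq0.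
Qed.

(** Symmetric elimination; congruences preserve [free_act], so [free_pivot]
    supplies a pivot at every stage. *)
Lemma nf_exists B : symm B -> free_act B ->
  exists h t, unip h /\ nf (h *m B *m h^T) t.
Proof.
suff H d m B' t : (n - m <= d)%N -> symm B' -> free_act B' -> nf_upto m B' t ->
    exists h t', unip h /\ nf (h *m B' *m h^T) t'.
  by move=> sB fB; apply: (H n 0%N B id) => //; rewrite subn0.
elim: d m B' t => [|d IH] m B' t nm sB fB nfB; (case: (leqP n m.+1) => mn;
  [exists 1%:M, (fun i => if (i < m)%N then t i else i); split; [exact: unip1 |
   by rewrite trmx1 mulmx1 mul1mx; exact: nf_upto_end] | ]).
  by lia.
have step h m' t' : unip h -> (m < m')%N -> nf_upto m' (h *m B' *m h^T) t' ->
    exists h t'', unip h /\ nf (h *m B' *m h^T) t''.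
  move=> uh mm' nf'; have [|//|//|h' [t'' [uh' nf'']]] := IH m' _ t' _ _ _ nf'.
  - by lia.
  - exact: symm_conj.
  - exact: free_act_conj.
  - by exists (h' *m h), t''; split; [exact: unipM | rewrite trmx_mul !mulmxA in nf'' *].
pose k := Ordinal (ltnW mn); pose l := Ordinal mn.
have [Bkk|Bkk] := eqVneq (B' k k) 0.
  have Bkl := free_pivot (k := k) (l := l) sB nfB erefl erefl fB Bkk.
  have [h uh nfh] := pivot_pair (k := k) (l := l) sB nfB erefl erefl Bkk Bkl.
  by apply: step uh _ nfh.
have [h uh nfh] := pivot_diag (k := k) sB nfB erefl Bkk.
by apply: step uh _ nfh.
Qed.

End NormalForm.

(** * Maximal orthogonal subsets as tilings *)
Section Tilings.
Variable n : nat.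
Implicit Types (a b : posroot n) (D : {set posroot n}) (i j : 'I_n) (t : 'I_n -> 'I_n).

(** For roots in [Dreg], whose coordinates are nonnegative, orthogonality means
    that the supports are disjoint. *)
Definition touch a i : bool :=
  match a with
  | Long j => i == j
  | Sum jk | Diff jk => (i == (val jk).1) || (i == (val jk).2)
  end.

(** On the support of [a], exchanges the two indices of a domino and fixes a
    single point. *)
Definition partner a i : 'I_n :=
  match a with
  | Long j => j
  | Sum jk | Diff jk => if i == (val jk).1 then (val jk).2 else (val jk).1
  end.

Lemma partner_touch a i : touch a i -> touch a (partner a i).
Proof. by case: a => [j|[[j k] jk]|[[j k] jk]] //= _; case: ifP; rewrite eqxx ?orbT. Qed.

Lemma partnerK a i : touch a i -> partner a (partner a i) = i.
Proof.
case: a => [j /eqP -> //|[[j k] /= jk]|[[j k] /= jk]].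
all: case: (i =P j) => [-> _|_ /= /eqP ->]; rewrite ?eqxx //.
all: by have -> : (k == j) = false by apply/eqP => E; move: jk; rewrite E ltnn.
Qed.

Lemma rootvec_touch a i : a \in Dreg n ->
  0 <= rootvec a 0 i /\ (rootvec a 0 i == 0) = ~~ touch a i.
Proof.
rewrite inE; case: a => [j _|[[j k] /= jk] _|//]; rewrite ?mulr2n !mxE /=.
  by case: (i == j).
by case: (i == j); case: (i == k).
Qed.

Lemma inner_Dreg a b : a \in Dreg n -> b \in Dreg n ->
  (inner (rootvec a) (rootvec b) == 0) = [forall i, ~~ (touch a i && touch b i)].
Proof.
move=> Da Db; rewrite /inner Num.Theory.psumr_eq0 => [|i _]; last first.
  have [? _] := rootvec_touch i Da; have [? _] := rootvec_touch i Db.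
  exact: Num.Theory.mulr_ge0.
apply/allP/forallP => [H i|H i _].
  have := H i (mem_index_enum i); rewrite /= mulf_eq0.
  have [_ ->] := rootvec_touch i Da; have [_ ->] := rootvec_touch i Db.
  by rewrite negb_and.
rewrite /= mulf_eq0.
have [_ ->] := rootvec_touch i Da; have [_ ->] := rootvec_touch i Db.
by rewrite -negb_and.
Qed.

Definition disjoint_roots D :=
  forall a b i, a \in D -> b \in D -> touch a i -> touch b i -> a = b.

Lemma pairwise_orthogonalP D : D \subset Dreg n ->
  reflect (disjoint_roots D) (Defs.pairwise_orthogonal D).
Proof.
move=> /subsetP DD; apply: (iffP forall_inP) => [H a b i Da Db ai bi|H a Da].
  apply/eqP; move: (H a Da) => /forall_inP/(_ b Db); apply: contraTT => /= ab.
  rewrite ab implyTb inner_Dreg ?DD //; apply/forallP => /(_ i).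
  by rewrite ai bi.
apply/forall_inP => b Db; apply/implyP => ab; rewrite inner_Dreg ?DD //.
apply/forallP => i; apply: contra ab => /andP[ai bi]; apply/eqP; exact: H ai bi.
Qed.

Definition roots_of t : {set posroot n} :=
  [set a | match a with
           | Long i => t i == i
           | Sum ij => t (val ij).1 == (val ij).2
           | Diff _ => false
           end].

Lemma roots_of_Dreg t : tiling t -> roots_of t \subset Dreg n.
Proof.
move=> [_ tS]; apply/subsetP => -[i|[[i j] /= ij]|[[i j] /= ij]]; rewrite !inE //=.
by move=> /eqP E; have := tS i; rewrite E; lia.
Qed.

Lemma roots_of_disjoint t : tiling t -> disjoint_roots (roots_of t).
Proof.
move=> [tK _] a b i; rewrite !inE.
case: a => [j|[[j k] /= jk]|//]; case: b => [j'|[[j' k'] /= jk']|//] /= /eqP E /eqP E'.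
- by move=> /eqP <- /eqP <-.
- move=> /eqP ->; have tk' : t k' = j' by rewrite -E' tK.
  case/orP => /eqP ji; exfalso; move: jk'.
    by rewrite -E' -ji E ltnn.
  by rewrite -tk' -ji E ltnn.
- have tk : t k = j by rewrite -E tK.
  case/orP => /eqP -> /eqP ji; exfalso; move: jk.
    by rewrite -E ji E' ltnn.
  by rewrite -tk ji E' ltnn.
- have tk : t k = j by rewrite -E tK.
  have tk' : t k' = j' by rewrite -E' tK.
  have jE : j = j' -> Sum (exist _ (j, k) jk) = Sum (exist _ (j', k') jk' : ltpair n).
    by move=> jj'; congr Sum; apply: val_inj; rewrite /= -E -E' jj'.
  case/orP => /eqP -> /orP[] /eqP ij; try exact: jE.
  + have kj : k = j' by rewrite -E ij tk'.
    by exfalso; move: (jk) (jk'); rewrite kj ij; lia.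
  + have kj : k' = j by rewrite -E' -ij tk.
    by exfalso; move: (jk) (jk'); rewrite kj ij; lia.
  + by apply: jE; rewrite -tk ij tk'.
Qed.

Lemma roots_of_cover t i : tiling t -> exists2 a, a \in roots_of t & touch a i.
Proof.
move=> [tK _]; case: (ltngtP (t i) i) => ti.
- by exists (Sum (exist _ (t i, i) ti : ltpair n)); rewrite ?inE /= ?tK ?eqxx ?orbT.
- by exists (Sum (exist _ (i, t i) ti : ltpair n)); rewrite ?inE /= ?eqxx.
- by exists (Long i); rewrite ?inE /= -?val_eqE /= ?ti.
Qed.

(** A maximal orthogonal subset is a tiling of the indices by single points
    [2 eps_i] and dominoes [eps_i + eps_(i+1)]; the involution exchanges the two
    halves of each domino. *)
Lemma max_orthogonalP D :
  max_orthogonal D <-> exists2 t, tiling t & D = roots_of t.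
Proof.
split=> [/maxsetP[/andP[DD orD] maxD]|[t tilt ->]]; last first.
  have RD := roots_of_Dreg tilt.
  apply/maxsetP; rewrite RD; split.
    by apply/(pairwise_orthogonalP RD); exact: roots_of_disjoint.
  move=> E /andP[ED /(pairwise_orthogonalP ED) orE] RE.
  apply/eqP; rewrite eqEsubset RE andbT; apply/subsetP => b Eb.
  have [i bi] : exists i, touch b i.
    by case: b Eb => [i|[[i j] ij]|[[i j] ij]] _; exists i; rewrite /= eqxx.
  have [a Ra ai] := roots_of_cover i tilt.
  by rewrite (orE b a i) //; exact: (subsetP RE).
have disD := elimT (pairwise_orthogonalP DD) orD.
have cover i : exists2 a, a \in D & touch a i.
  case: (pickP (fun a => (a \in D) && touch a i)) => [a /andP[Da ai]|no].
    by exists a.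
  have noD a : a \in D -> ~~ touch a i by move=> Da; have := no a; rewrite Da /= => ->.
  (* by maximality, an index met by no root of [D] leaves room for [Long i] *)
  suff LD : Long i \in D by have := noD _ LD; rewrite /= eqxx.
  have UD : Long i |: D \subset Dreg n.
    by rewrite subUset DD andbT sub1set inE.
  rewrite -(maxD (Long i |: D)) ?setU11 ?subsetUr // UD /=.
  apply/(pairwise_orthogonalP UD) => a b j.
  case/setU1P => [->|Da] /setU1P[->|Db] //=; last exact: disD.
    by move=> /eqP -> bi; have := noD b Db; rewrite bi.
  by move=> ai /eqP ji; have := noD a Da; rewrite -ji ai.
pose t i := if [pick a | (a \in D) && touch a i] is Some a then partner a i else i.
have tE a i : a \in D -> touch a i -> t i = partner a i.
  move=> Da ai; rewrite /t; case: pickP => [b /andP[Db bi]|/(_ a)]; last first.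
    by rewrite Da ai.
  by rewrite (disD a b i).
have tilt : tiling t.
  split=> i; have [a Da ai] := cover i; rewrite (tE _ _ Da ai).
    by rewrite (tE _ _ Da (partner_touch ai)) partnerK.
  move/subsetP/(_ a Da): DD; rewrite inE.
  case: a ai {Da} => [j /= /eqP -> //|[[j k] /= jk]|//].
  by case: eqP => [-> _ /eqP ->|_ /= /eqP -> _] //; exact: leq_trans (ltnW jk) _.
exists t => //; apply/esym/maxD; first by rewrite roots_of_Dreg //=;
  apply/pairwise_orthogonalP; [exact: roots_of_Dreg | exact: roots_of_disjoint].
apply/subsetP => a Da; have := subsetP DD _ Da; rewrite !inE.
case: a Da => [j|[[j k] /= jk]|//] Da _.
  by rewrite (tE _ _ Da) //= eqxx.
by rewrite (tE _ _ Da) /= ?eqxx.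
Qed.

End Tilings.

(** * Linear forms attached to tilings *)
Section Forms.
Variables (F : finFieldType) (n : nat).
Implicit Types (f : udual F n) (D : {set posroot n}) (xi : posroot n -> F)
  (t : 'I_n -> 'I_n).

Lemma rootelt_umx (a : posroot n) :
  rootelt F a = match a with
              | Long i => umx 0 (delta_mx i i)
              | Sum ij => umx 0 (delta_mx (val ij).1 (val ij).2 + delta_mx (val ij).2 (val ij).1)
              | Diff ij => umx (delta_mx (val ij).2 (val ij).1) 0
              end.
Proof.
apply/matrixP => c d; case: a => [i|[[i j] /= ij]|[[i j] /= ij]];
  case: (indexP c) => k; case: (indexP d) => l;
  rewrite /umx bmxE !mxE ?(pos_neg, neg_pos, pos_eq, neg_eq) ?(andbF, andbT) /=;
  repeat case: eqP => _ /=; ring.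
Qed.

Lemma udual_rootelt f f' :
  (forall b, uval f (rootelt F b) = uval f' (rootelt F b)) -> f = f'.
Proof.
move=> H; apply: udual_eq => x /coord_span ->; rewrite !uval_sum.
by apply: eq_bigr => b _; rewrite !uvalZ nth_codom H.
Qed.

Lemma form_of_rootelt D xi b :
  uval (form_of D xi) (rootelt F b) = if b \in D then xi b else 0.
Proof.
have -> : uval (form_of D xi) (rootelt F b) =
          \sum_(a in D) xi a * (a == b)%:R.
  rewrite /uval /form_of sum_lfunE; apply: eq_bigr => a _.
  by rewrite scale_lfunE rootdualE.
case: ifP => Db.
  rewrite (bigD1 b) //= eqxx mulr1 big1 ?addr0 // => a /andP[_ /negPf ->].
  by rewrite mulr0.
by rewrite big1 // => a Da; case: eqP Db Da => [<- ->|]; rewrite ?mulr0.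
Qed.

Lemma form_of_eq D xi f :
  (forall b, b \in D -> xi b = uval f (rootelt F b)) ->
  (forall b, b \notin D -> uval f (rootelt F b) = 0) -> f = form_of D xi.
Proof.
move=> H H0; apply: udual_rootelt => b; rewrite form_of_rootelt.
by case: (boolP (b \in D)) => [/H|/H0].
Qed.

Hypothesis two_neq0 : 2%:R != 0 :> F.

Lemma uval_rootelt f (a : posroot n) :
  uval f (rootelt F a) = match a with
              | Long i => spart f i i
              | Sum ij => 2%:R * spart f (val ij).1 (val ij).2
              | Diff ij => upart f (val ij).1 (val ij).2
              end.
Proof.
rewrite rootelt_umx; case: a => [i|[[i j] /= ij]|[[i j] /= ij]]; rewrite mxE.
- by rewrite -mulr2n -scaler_nat umx0Z uvalZ mulKf.
- by rewrite mulVKf.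
- by rewrite ij.
Qed.

Lemma spart_off f (i j : 'I_n) (ij : (i < j)%N) :
  spart f i j = 2%:R^-1 * uval f (rootelt F (Sum (exist _ (i, j) ij : ltpair n))).
Proof. by rewrite uval_rootelt /= mulKf. Qed.

(** The nonvanishing of [xi] on [D] except at [2 eps_n] is exactly the
    nonvanishing required by [nf] at all indices but the last. *)
Lemma admissible_nf D xi : admissible D xi ->
  upart (form_of D xi) = 0 /\ exists t, nf (spart (form_of D xi)) t.
Proof.
move=> [/max_orthogonalP[t tilt DE] nz]; have [tK tS] := tilt.
set f := form_of D xi; have fE b := form_of_rootelt D xi b; rewrite -/f in fE.
have symf i j : spart f i j = spart f j i by rewrite -{1}(eqP (spart_symm f)) mxE.
split.
  apply/matrixP => i j; rewrite mxE [RHS]mxE; case: ifP => // ij.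
  have := fE (Diff (exist _ (i, j) ij : ltpair n)).
  by rewrite rootelt_umx /= DE inE.
have offE (i j : 'I_n) (ij : (i < j)%N) :
    spart f i j = if t i == j then 2%:R^-1 * xi (Sum (exist _ (i, j) ij : ltpair n)) else 0.
  by rewrite spart_off fE DE inE /=; case: ifP => // _; rewrite mulr0.
have diagE i : spart f i i = if t i == i then xi (Long i) else 0.
  by rewrite -[LHS](uval_rootelt f (Long i)) fE DE inE.
exists t; split=> // [i j|i im].
- case: (ltngtP i j) => [ij|ji|/val_inj ->].
  + by rewrite (offE _ _ ij); case: (t i =P j) => [->|]; rewrite ?eqxx.
  + by rewrite symf (offE _ _ ji); case: (t j =P i) => [tj _|]; rewrite ?eqxx // -tj tK.
  + by rewrite diagE; case: (t j =P j) => [->|]; rewrite ?eqxx.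
- case: (ltngtP i (t i)) => [iti|tii|/val_inj ti].
  + rewrite (offE _ _ iti) eqxx mulf_neq0 ?invr_eq0 //.
    by apply: nz; rewrite // DE inE /=.
  + rewrite symf (offE _ _ tii) tK eqxx mulf_neq0 ?invr_eq0 //.
    by apply: nz; rewrite // DE inE /= tK.
  + rewrite -ti diagE -ti eqxx; apply: nz; rewrite /= ?DE ?inE -?ti //.
    by rewrite ltn_eqF.
Qed.

Lemma nf_admissible f t : upart f = 0 -> nf (spart f) t ->
  exists D xi, admissible D xi /\ f = form_of D xi.
Proof.
move=> uf0 [tilt sup nz]; exists (roots_of t), (fun b => uval f (rootelt F b)); split.
  split=> [|b]; first by apply/max_orthogonalP; exists t.
  rewrite inE uval_rootelt; case: b => [i|[[i j] /= ij]|//] /= /eqP ti.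
    move=> i_last; rewrite -{2}ti; apply: nz; have := ltn_ord i; lia.
  by move=> _; rewrite mulf_neq0 // -ti nz //; have := ltn_ord j; lia.
apply: form_of_eq => // b; rewrite inE uval_rootelt.
case: b => [i|[[i j] /= ij]|[[i j] /= ij]] /= => [ti|ti|_].
- by rewrite (supported0 sup) // eq_sym.
- by rewrite (supported0 sup) ?mulr0 // eq_sym.
- by rewrite uf0 mxE.
Qed.

End Forms.

(** * Rank one *)
Section RankOne.
Variables (F : finFieldType) (p : nat).
Hypotheses (charp : p \in [pchar F]) (np : (2 * 1 <= p)%N).

(** Here [u] consists of square-zero matrices with pairwise zero products, which
    therefore commute with every exponential. *)
Lemma coad_rank1 (f f' : udual F 1) : f' \in coad_orbit f -> f' = f.
Proof.
case/imsetP=> _ /imsetP[y yu ->] ->; apply: udual_eq => x xu; rewrite uval_coad //.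
have mul0 u v : u \in ualg F 1 -> v \in ualg F 1 -> u *m v = 0.
  move=> /ualgP[lu _] /ualgP[lv _].
  by apply: (@low_nilp _ _ 2) => //; rewrite -[2%N]/(1 + 1)%N; exact: lowM.
have [uy _] := sp_unipP _ (mexp_sp_unip (isT : (0 < 1)%N) charp np yu).
have yx : mexp y *m x = x *m mexp y.
  rewrite mulmx_suml mulmx_sumr; apply: eq_bigr => -[[|i] im] _ /=;
    rewrite -scalemxAl -scalemxAr.
    by rewrite !expr0 [1 *m _]mul1mx [_ *m 1]mulmx1.
  have -> : y ^+ i.+1 *m x = y ^+ i *m (y *m x) by rewrite exprSr mulmxA.
  have -> : x *m y ^+ i.+1 = x *m y *m y ^+ i by rewrite exprS -mulmxA.
  by rewrite (mul0 y x) // (mul0 x y) // mulmx0 mul0mx.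
by rewrite -mulmxA -yx mulKmx // unip_unit.
Qed.

Lemma orbit_rank1 (f : udual F 1) : coad_orbit f = [set f].
Proof.
apply/setP => f'; rewrite inE; apply/idP/eqP => [/coad_rank1 //|->].
have : coad (mexp 0) f \in coad_orbit f by apply/imset_f/imset_f; exact: mem0v.
by move/[dup]/coad_rank1 ->.
Qed.

Lemma form_rank1 (f : udual F 1) : exists D xi, admissible D xi /\ f = form_of D xi.
Proof.
exists (roots_of id), (fun b => uval f (rootelt F b)); split.
  split=> [|b]; first by apply/max_orthogonalP; exists id.
  by case: b => [[[] //]|[[i j] ij]|[[i j] ij]] //; exfalso; move: ij; rewrite !ord1 ltnn.
apply: form_of_eq => // -[i|[[i j] ij]|[[i j] ij]].
- by rewrite inE eqxx.
- by exfalso; move: ij; rewrite !ord1 ltnn.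
- by exfalso; move: ij; rewrite !ord1 ltnn.
Qed.

End RankOne.

(** * Orbits of maximal dimension *)
Section Maximal.
Variables (F : finFieldType) (n p : nat).
Hypothesis two_neq0 : 2%:R != 0 :> F.
Hypotheses (n_gt0 : (0 < n)%N) (charp : p \in [pchar F]) (np : (2 * n <= p)%N).
Implicit Types (f : udual F n).

Lemma card_admissible (D : {set posroot n}) (xi : posroot n -> F) : admissible D xi ->
  #|coad_orbit (form_of D xi)| = (#|unips F n| * #|suppers F n|)%N.
Proof.
move=> /(admissible_nf two_neq0)[_ [t nft]].
exact: (low_solvable_card two_neq0 n_gt0 charp np (nf_low_solvable nft)).
Qed.

(** The bound on orbit sizes is attained by the tiling without dominoes, so
    having maximal dimension amounts to reaching the bound. *)
Lemma max_dimP f :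
  max_dim (coad_orbit f) <-> #|coad_orbit f| = (#|unips F n| * #|suppers F n|)%N.
Proof.
have q1 : (1 < #|F|)%N by exact: finNzRing_gt1.
have orbit_dim := coad_orbit_card two_neq0 n_gt0 charp np.
have orbit_le f' : (#|coad_orbit f'| <= #|unips F n| * #|suppers F n|)%N.
  apply: leq_trans (orbit_card_le two_neq0 n_gt0 charp np f') _.
  by rewrite leq_mul2r card_congr_orbit orbT.
split=> [[d dimd maxd]|E].
  apply/eqP; rewrite eqn_leq orbit_le andTb.
  have adm : admissible (roots_of (@id 'I_n)) (fun=> 1 : F).
    by split=> [|b _ _]; [apply/max_orthogonalP; exists id | exact: oner_neq0].
  have [d' dimd' d'd] := maxd (form_of (roots_of id) (fun=> 1)).
  by rewrite -(card_admissible adm) dimd dimd' leq_pexp2l // ltnW.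
have [d dimd] := orbit_dim f; exists d => // f'.
have [d' dimd'] := orbit_dim f'; exists d' => //.
by rewrite -(leq_exp2l _ _ q1) -dimd -dimd' E.
Qed.

(** First bring the symmetric part to normal form, then use that normal forms
    are [low_solvable] to translate the strictly upper part to zero. *)
Lemma max_dim_form f : max_dim (coad_orbit f) ->
  exists2 f', f' \in coad_orbit f & exists D xi, admissible D xi /\ f' = form_of D xi.
Proof.
move=> /max_dimP/esym/eq_leq cardO.
have fB := max_free two_neq0 n_gt0 charp np cardO.
have [k [t [uk nfk]]] := nf_exists two_neq0 (spart_symm f) fB.
set B := k *m _ *m _ in nfk.
have [s ss sE] := nf_low_solvable nfk (2%:R^-1 *: (k *m upart f *m invmx k)).
exists (coad (gmx k s) f); first by apply/(coad_orbitP two_neq0 n_gt0 charp np); exists k, s.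
apply: (@nf_admissible _ _ two_neq0 _ t); last by rewrite spart_coad.
rewrite upart_coad // -/B -(@supper0 F n); apply: supper_eq.
rewrite subr0 -opprB; apply: lowN.
have -> : 2%:R *: (B *m s) - k *m upart f *m invmx k =
          2%:R *: (B *m s - 2%:R^-1 *: (k *m upart f *m invmx k)).
  by rewrite scalerBr scalerA mulfV // scale1r.
exact: lowZ.
Qed.

(** The symmetric parts of two forms in one orbit are congruent, and the
    strictly upper parts of both vanish. *)
Lemma orbit_form_unique f (D D' : {set posroot n}) (xi xi' : posroot n -> F) :
  admissible D xi -> admissible D' xi' ->
  form_of D xi \in coad_orbit f -> form_of D' xi' \in coad_orbit f ->
  form_of D xi = form_of D' xi'.
Proof.
move=> /(admissible_nf two_neq0)[u0 [t [_ sup _]]] /(admissible_nf two_neq0)[u0' [t' [_ sup' _]]].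
move: (form_of D xi) (form_of D' xi') u0 sup u0' sup' => g g' u0 sup u0' sup'.
move=> /(coad_orbitP two_neq0 n_gt0 charp np)[k [s [uk ss gE]]].
move=> /(coad_orbitP two_neq0 n_gt0 charp np)[k' [s' [uk' ss' gE']]].
apply: (parts_inj two_neq0); first by rewrite u0.
apply: (congr_supported_eq (h := k' *m invmx k) (spart_symm g) (spart_symm g') sup sup').
  by apply: unipM => //; exact: unipV.
rewrite gE gE' !spart_coad // trmx_mul !mulmxA.
rewrite -(mulmxA k' (invmx k) k) mulVmx ?unip_unit // mulmx1.
by rewrite -(mulmxA _ k^T) -trmx_mul mulVmx ?unip_unit // trmx1 mulmx1.
Qed.

End Maximal.

Theorem theorem4p5 (F : finFieldType) (n p : nat)
    (hn : (1 <= n)%N) (hp : p \in [pchar F]) (hpn : (2 * n <= p)%N) :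
  (forall (D : {set posroot n}) (xi : posroot n -> F),
     admissible D xi -> max_dim (coad_orbit (form_of D xi)))
  /\
  (forall h : udual F n, max_dim (coad_orbit h) ->
     exists! f : udual F n,
       f \in coad_orbit h /\
       exists (D : {set posroot n}) (xi : posroot n -> F),
         admissible D xi /\ f = form_of D xi).
Proof.
have [n1|n_neq1] := eqVneq n 1%N.
  subst n; have orbit1 := orbit_rank1 hp hpn.
  split=> [D xi _|h _].
    exists 0%N => [|f]; first by rewrite /has_dim orbit1 cards1.
    by exists 0%N; rewrite // /has_dim orbit1 cards1.
  exists h; rewrite orbit1; split; first by rewrite inE eqxx; split=> //; exact: form_rank1.
  by move=> f; rewrite inE => -[/eqP ->].
have two_neq0 : 2%:R != 0 :> F.
  by rewrite -(dvdn_pcharf hp); apply/negP => /dvdn_leq; lia.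
split=> [D xi adm|h maxh].
  by apply/(max_dimP two_neq0 hn hp hpn); rewrite (card_admissible two_neq0 hn hp hpn).
have [f hf [D [xi [adm fE]]]] := max_dim_form two_neq0 hn hp hpn maxh.
exists f; split=> [|f' [hf' [D' [xi' [adm' fE']]]]]; first by split=> //; exists D, xi.
rewrite fE fE'; apply: (orbit_form_unique two_neq0 hn hp hpn (f := h) adm adm').
- by rewrite -fE.
- by rewrite -fE'.
Qed.
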